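(* Suppose Assumptions 1--7, 9 and 10 listed in the context hold (with $\alpha>1$ from Assumption 9 and $\beta>0$ from Assumption 10), and let $\epsilon_n>0$ be a sequence with $\epsilon_n\to 0$. Let $\widehat R_{XY}=(\widehat\Sigma_{XX}+\epsilon_n I)^{-1}\widehat\Sigma_{XY}$ be the estimated regression operator and $R_{XY}=\Sigma_{XX}^{\dagger}\Sigma_{XY}$ the regression operator. Then, as $n\to\infty$, $$\|\widehat R_{XY}-R_{XY}\|_{\mathrm{OP}}=O_p\left(n^{-1/2}\epsilon_n^{(\beta\wedge 1)-1}+\epsilon_n^{\beta\wedge 1}+n^{-1}\epsilon_n^{-(3\alpha+1)/(2\alpha)}+n^{-1/2}\epsilon_n^{-(\alpha+1)/(2\alpha)}\right),$$ where $\|\cdot\|_{\mathrm{OP}}$ is the operator norm and $a\wedge b=\min(a,b)$.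
   Context: Setting. $(\Omega,\mathcal F,P)$ is a probability space; $\Omega_X\subseteq\mathbb R^p$, $\Omega_Y\subseteq\mathbb R^q$; $X:\Omega\to\Omega_X$, $Y:\Omega\to\Omega_Y$ are Borel random vectors with distributions $P_X,P_Y$. $\kappa_X,\kappa_Y$ are positive definite kernels on $\Omega_X\times\Omega_X$, $\Omega_Y\times\Omega_Y$ with reproducing kernel Hilbert spaces $\mathcal H_X,\mathcal H_Y$. For Hilbert space elements, $(u\otimes v)w=\langle v,w\rangle u$. Mean elements: $\mu_X=E\{\kappa_X(\cdot,X)\}$, $\mu_Y=E\{\kappa_Y(\cdot,Y)\}$. Covariance operators: $\Sigma_{XX}=E[\{\kappa_X(\cdot,X)-\mu_X\}\otimes\{\kappa_X(\cdot,X)-\mu_X\}]:\mathcal H_X\to\mathcal H_X$, $\Sigma_{XY}=E[\{\kappa_X(\cdot,X)-\mu_X\}\otimes\{\kappa_Y(\cdot,Y)-\mu_Y\}]:\mathcal H_Y\to\mathcal H_X$, $\Sigma_{YX}=\Sigma_{XY}^*$. For a bounded operator $A$, the Moore--Penrose inverse $A^\dagger:\mathrm{ran}(A)\to\ker(A)^\perp$ is the inverse of the restriction of $A$ to $\ker(A)^\perp$. The regression operator is $R_{XY}=\Sigma_{XX}^\dagger\Sigma_{XY}:\mathcal H_Y\to\mathcal H_X$. Sample. $(X_1,Y_1),\dots,(X_n,Y_n)$ are i.i.d. copies of $(X,Y)$; $E_n$ denotes the sample average. $\widehat\mu_X=E_n\{\kappa_X(\cdot,X)\}$, $\widehat\mu_Y=E_n\{\kappa_Y(\cdot,Y)\}$,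 $\widehat\Sigma_{XX}=E_n[\{\kappa_X(\cdot,X)-\widehat\mu_X\}\otimes\{\kappa_X(\cdot,X)-\widehat\mu_X\}]$, $\widehat\Sigma_{XY}=E_n[\{\kappa_X(\cdot,X)-\widehat\mu_X\}\otimes\{\kappa_Y(\cdot,Y)-\widehat\mu_Y\}]$. Assumptions. 1. $\mathcal H_X$, $\mathcal H_Y$ are dense subsets of $L_2(P_X)$, $L_2(P_Y)$ modulo constants: for every $f\in L_2(P_X)$ there is $\{f_n\}\subset\mathcal H_X$ with $\mathrm{var}[f_n(X)-f(X)]\to0$, and similarly for $\mathcal H_Y$. 2. $\kappa_X$ and $\kappa_Y$ are bounded and continuous. 3. $\mathrm{ran}(\Sigma_{XY})\subseteq\mathrm{ran}(\Sigma_{XX})$. 4. $R_{XY}$ is a bounded operator. 5. The family of conditional distributions $\{P_{X|Y}(\cdot|y):y\in\Omega_Y\}$ is dominated by a $\sigma$-finite measure. 6. There exist $f_1,\dots,f_d\in\mathcal H_X$ such that $Y$ and $X$ are conditionally independent given $f_1(X),\dots,f_d(X)$, and $\sigma\{f_1(X),\dots,f_d(X)\}$ is minimal: whenever $g_1,\dots,g_{d'}\in\mathcal H_X$ are such that $Y$ and $X$ are conditionally independent given $g_1(X),\dots,g_{d'}(X)$, then $\sigma\{f_1(X),\dots,f_d(X)\}\subseteq\sigma\{g_1(X),\dots,g_{d'}(X)\}$. 7. $R_{XY}$ has rank $d$. 9. The eigenvalues $\lambda_1\ge\lambda_2\ge\cdots$ of $\Sigma_{XX}$ satisfy $\lambda_j\asymp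 j^{-\alpha}$ for all $j\in\mathbb N$ for some $\alpha>1$ (i.e. $\lambda_j/j^{-\alpha}$ and $j^{-\alpha}/\lambda_j$ are bounded). 10. There are $\beta>0$ and a bounded linear operator $S_{XY}:\mathcal H_Y\to\mathcal H_X$ with $\Sigma_{XY}=\Sigma_{XX}^{1+\beta}S_{XY}$. *)

(* Defs.v *)
From HB Require Import structures.
From mathcomp Require Import all_boot all_order all_algebra.
From mathcomp Require Import all_classical all_reals all_analysis.
From mathcomp Require Import measurable_realfun.

Set Implicit Arguments.
Unset Strict Implicit.
Unset Printing Implicit Defensive.

Import Order.TTheory GRing.Theory Num.Theory.
Import numFieldNormedType.Exports.

Local Open Scope classical_set_scope.
Local Open Scope ring_scope.

(* [set_type O] carries the subspace topology.  MathComp-Analysis requires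
   measurable types to be pointed, hence the nonemptiness argument (which any
   random element of [O] provides). *)
Definition region (R : realType) (p : nat) (O : set 'rV[R]_p)
  (O0 : O !=set0) : Type := set_type O.

Definition region_point (R : realType) (p : nat) (O : set 'rV[R]_p)
    (O0 : O !=set0) : region O0 :=
  let: exist x Ox := cid O0 in exist _ x (mem_set Ox).

HB.instance Definition _ (R : realType) (p : nat) (O : set 'rV[R]_p)
    (O0 : O !=set0) :=
  Topological.copy (region O0) (set_type O).
HB.instance Definition _ (R : realType) (p : nat) (O : set 'rV[R]_p)
    (O0 : O !=set0) :=
  isPointed.Build (region O0) (region_point O0).

HB.instance Definition _ (R : realType) (p : nat) (O : set 'rV[R]_p)
    (O0 : O !=set0) :=
  Measurable.copy (region O0) (g_sigma_algebraType (@open (region O0))).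

HB.mixin Record NormedModule_hasDot (R : realType) H of NormedModule R H := {
  dot : H -> H -> R;
  dotC : forall u v, dot u v = dot v u;
  dot_linearl : forall a u v w, dot (a *: u + v) w = a * dot u w + dot v w;
  dot_norm : forall u, dot u u = `|u| ^+ 2
}.

#[short(type="hilbertType")]
HB.structure Definition Hilbert (R : realType) :=
  {H of CompleteNormedModule R H & NormedModule_hasDot R H}.

Definition tensor (R : realType) (H1 H2 : hilbertType R) (u : H1) (v : H2) :
  H2 -> H1 := fun w => dot v w *: u.

(* Defined for all maps; [+oo] when no [M] exists. *)
Definition opnorm (R : realType) (E F : normedModType R) (A : E -> F) : \bar R :=
  ereal_inf [set M%:E | M in [set M : R | 0 <= M /\
    forall x, `|A x| <= M * `|x|]].

Definition bounded_operator (R : realType) (E F : normedModType R)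
    (A : E -> F) : Prop :=
  linear A /\ (opnorm A < +oo)%E.

Definition orthogonal_compl (R : realType) (H : hilbertType R) (W : set H) :
  set H := [set x | forall z, W z -> dot x z = 0].

Definition operator_ker (R : realType) (E F : normedModType R) (A : E -> F) :
  set E := [set x | A x = 0].

(* The inverse of the restriction of [A] to [ker(A)^perp], extended by the
   junk value 0 outside [A @` ker(A)^perp], which is [ran(A)] for bounded A. *)
Definition moore_penrose (R : realType) (H : hilbertType R)
    (F : normedModType R) (A : H -> F) : F -> H :=
  'pinv_(fun=> 0) (orthogonal_compl (operator_ker A)) A.

Definition operator_inv (R : realType) (E F : normedModType R) (A : E -> F) :
  F -> E := 'pinv_(fun=> 0) setT A.

Definition has_dim (R : realType) (V : lmodType R) (W : set V) (n : nat) :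
    Prop :=
  exists e : 'I_n -> V,
    (forall c : 'I_n -> R, \sum_i c i *: e i = 0 -> forall i, c i = 0) /\
    W = [set v | exists c : 'I_n -> R, v = \sum_i c i *: e i].

Definition has_rank (R : realType) (E F : normedModType R) (A : E -> F)
  (n : nat) : Prop := has_dim (range A) n.

(* [lam 0 >= lam 1 >= ...] lists the nonzero eigenvalues of [A], each repeated
   according to its multiplicity [dim ker (A - t I)]. *)
Definition eigenvalues (R : realType) (E : normedModType R) (A : E -> E)
    (lam : nat -> R) : Prop :=
  (forall i j, (i <= j)%N -> lam j <= lam i) /\
  forall t : R, t != 0 -> exists n,
    has_dim [set x | A x = t *: x] n /\ ([set j | lam j = t] #= `I_n)%card.

(* Spectral decomposition [A = sum_j lam_j phi_j (x) phi_j] of a compact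
   positive operator.  Indices with [lam j = 0] are padding (needed when [A] has
   finite rank): nothing is required of the norm of [phi j] there. *)
Definition spectral_decomposition (R : realType) (H : hilbertType R)
    (A : H -> H) (lam : nat -> R) (phi : nat -> H) : Prop :=
  [/\ forall j, 0 <= lam j,
      forall i j, 0 < lam i -> 0 < lam j -> dot (phi i) (phi j) = (i == j)%:R,
      forall j, A (phi j) = lam j *: phi j &
      forall x, (forall j, 0 < lam j -> dot (phi j) x = 0) -> A x = 0].

(* [B = A ^ s], [s > 0], for a compact positive operator [A]:
   [B x = sum_j lam_j^s <phi_j, x> phi_j]. *)
Definition is_operator_power (R : realType) (H : hilbertType R)
    (A : H -> H) (s : R) (B : H -> H) : Prop :=
  exists (lam : nat -> R) (phi : nat -> H),
    spectral_decomposition A lam phi /\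
    forall x,
      series (fun j => (lam j `^ s * dot (phi j) x) *: phi j) @ \oo --> B x.

(* [u] is the Bochner integral of [Z] for the norm [N]: the simple functions
   [sum_k 1_(A n k) v_(n, k)] converge to [Z] in mean and their integrals
   converge to [u].  The norm is a parameter so that the definition also covers
   operators, viewed as elements of the module [E -> F], with [N := opnorm]. *)
Definition is_bochner (d : measure_display) (T : measurableType d)
    (R : realType) (P : probability T R) (V : lmodType R) (N : V -> \bar R)
    (Z : T -> V) (u : V) : Prop :=
  exists (m : nat -> nat) (A : nat -> nat -> set T) (v : nat -> nat -> V),
    let rest n w := N (Z w - \sum_(k < m n) (\1_(A n k) w : R) *: v n k) in
    [/\ forall n k, measurable (A n k),
        forall n, measurable_fun setT (rest n),
        (\int[P]_w rest n w)%E @[n --> \oo] --> 0%E &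
        N (\sum_(k < m n) fine (P (A n k)) *: v n k - u) @[n --> \oo] --> 0%E].

Definition bochner (d : measure_display) (T : measurableType d)
    (R : realType) (P : probability T R) (V : lmodType R) (N : V -> \bar R)
    (Z : T -> V) : V :=
  xget 0 [set u | is_bochner P N Z u].

Definition positive_definite_kernel (R : realType) (T : Type)
    (kappa : T -> T -> R) : Prop :=
  (forall x y, kappa x y = kappa y x) /\
  forall (n : nat) (x : 'I_n -> T) (c : 'I_n -> R),
    0 <= \sum_i \sum_j c i * c j * kappa (x i) (x j).

(* A Hilbert space of functions [T -> R] (its elements are turned into functions
   by the injection [rkhs_fun]) that contains every [kappa (., x)] and has the
   reproducing property. *)
Record rkhs (R : realType) (T : Type) (kappa : T -> T -> R) := Rkhs {
  rkhs_space :> hilbertType R;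
  rkhs_fun : rkhs_space -> T -> R;
  feature : T -> rkhs_space;
  rkhs_fun_linear : forall (a : R) (f g : rkhs_space) (x : T),
    rkhs_fun (a *: f + g) x = a * rkhs_fun f x + rkhs_fun g x;
  rkhs_fun_inj : injective rkhs_fun;
  featureE : forall x y, rkhs_fun (feature x) y = kappa y x;
  reproducing : forall f x, rkhs_fun f x = dot f (feature x)
}.

Definition bounded_kernel (R : realType) (T : Type) (kappa : T -> T -> R) :
  Prop := exists M : R, forall x y, `|kappa x y| <= M.

Definition continuous_kernel (R : realType) (T : topologicalType)
    (kappa : T -> T -> R) : Prop :=
  continuous (fun z : T * T => kappa z.1 z.2).

Definition mean_element (d : measure_display) (T : measurableType d)
    (U : Type) (R : realType) (P : probability T R)
    (kappa : U -> U -> R) (H : rkhs kappa) (X : T -> U) : H :=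
  bochner P (fun u : H => (`|u|)%:E) (fun w => feature H (X w)).
Arguments mean_element {d T U R} P {kappa} H X.

Definition cov_operator (d : measure_display) (T : measurableType d)
    (U1 U2 : Type) (R : realType)
    (P : probability T R) (kappa1 : U1 -> U1 -> R) (kappa2 : U2 -> U2 -> R)
    (H1 : rkhs kappa1) (H2 : rkhs kappa2) (X : T -> U1) (Y : T -> U2) :
    H2 -> H1 :=
  bochner P (fun A : H2 -> H1 => opnorm A)
    (fun w => tensor (feature H1 (X w) - mean_element P H1 X)
                     (feature H2 (Y w) - mean_element P H2 Y)).
Arguments cov_operator {d T U1 U2 R} P {kappa1 kappa2} H1 H2 X Y.

Definition regression_operator (d : measure_display)
    (T : measurableType d) (U1 U2 : Type) (R : realType) (P : probability T R)
    (kappa1 : U1 -> U1 -> R) (kappa2 : U2 -> U2 -> R)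
    (H1 : rkhs kappa1) (H2 : rkhs kappa2) (X : T -> U1) (Y : T -> U2) :
    H2 -> H1 :=
  moore_penrose (cov_operator P H1 H1 X X) \o cov_operator P H1 H2 X Y.
Arguments regression_operator {d T U1 U2 R} P {kappa1 kappa2} H1 H2 X Y.

(* The sample quantities use the observations of indices [0, ..., n - 1]. *)
Definition sample_mean_element (U : Type) (R : realType)
    (kappa : U -> U -> R) (H : rkhs kappa) (n : nat) (x : nat -> U) : H :=
  n%:R^-1 *: \sum_(i < n) feature H (x i).
Arguments sample_mean_element {U R kappa} H n x.

Definition sample_cov_operator (U1 U2 : Type) (R : realType)
    (kappa1 : U1 -> U1 -> R) (kappa2 : U2 -> U2 -> R)
    (H1 : rkhs kappa1) (H2 : rkhs kappa2) (n : nat)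
    (x : nat -> U1) (y : nat -> U2) : H2 -> H1 :=
  n%:R^-1 *: \sum_(i < n)
    tensor (feature H1 (x i) - sample_mean_element H1 n x)
           (feature H2 (y i) - sample_mean_element H2 n y).
Arguments sample_cov_operator {U1 U2 R kappa1 kappa2} H1 H2 n x y.

Definition sample_regression_operator (U1 U2 : Type) (R : realType)
    (kappa1 : U1 -> U1 -> R) (kappa2 : U2 -> U2 -> R)
    (H1 : rkhs kappa1) (H2 : rkhs kappa2) (eps : R) (n : nat)
    (x : nat -> U1) (y : nat -> U2) : H2 -> H1 :=
  operator_inv (fun f : H1 => sample_cov_operator H1 H1 n x x f + eps *: f)
    \o sample_cov_operator H1 H2 n x y.
Arguments sample_regression_operator {U1 U2 R kappa1 kappa2} H1 H2 eps n x y.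

Definition mutually_independent (d d' : measure_display)
    (T : measurableType d) (U : measurableType d') (R : realType)
    (P : probability T R) (Z : nat -> T -> U) : Prop :=
  forall (J : seq nat) (B : nat -> set U), uniq J ->
    (forall i, measurable (B i)) ->
    P (\bigcap_(i in [set` J]) (Z i @^-1` B i)) =
    (\prod_(i <- J) P (Z i @^-1` B i))%E.

Definition iid_copies (d d' : measure_display)
    (T : measurableType d) (U : measurableType d') (R : realType)
    (P : probability T R) (Z0 : T -> U) (Z : nat -> T -> U) : Prop :=
  mutually_independent P Z /\
  forall i B, measurable B -> P (Z i @^-1` B) = P (Z0 @^-1` B).

(* [h] is a version of the conditional probability [P(E | G)]. *)
Definition is_cond_prob (d : measure_display) (T : measurableType d)
    (R : realType) (P : probability T R) (G : set (set T)) (E : set T)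
    (h : T -> R) : Prop :=
  [/\ forall B : set R, measurable B -> G (h @^-1` B),
      P.-integrable setT (EFin \o h) &
      forall D, G D -> (\int[P]_(w in D) (h w)%:E)%E = P (E `&` D)].

(* [P(X in A, Y in B | G) = P(X in A | G) P(Y in B | G)] almost surely. *)
Definition cond_independent (d d1 d2 : measure_display)
    (T : measurableType d) (U1 : measurableType d1) (U2 : measurableType d2)
    (R : realType) (P : probability T R) (G : set (set T))
    (X : T -> U1) (Y : T -> U2) : Prop :=
  forall A B, measurable A -> measurable B ->
    exists hX hY : T -> R,
      [/\ is_cond_prob P G (X @^-1` A) hX,
          is_cond_prob P G (Y @^-1` B) hY &
          is_cond_prob P G (X @^-1` A `&` Y @^-1` B) (hX \* hY)].

Definition sigma_of (T U : Type) (R : realType) (kappa : U -> U -> R)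
    (H : rkhs kappa) (X : T -> U) (k : nat) (f : 'I_k -> H) : set (set T) :=
  g_sigma_preimage (fun i w => rkhs_fun (f i) (X w) : measurableTypeR R).

Definition minimal_sufficient (d d1 d2 : measure_display)
    (T : measurableType d) (U1 : measurableType d1) (U2 : measurableType d2)
    (R : realType) (P : probability T R) (kappa : U1 -> U1 -> R)
    (H : rkhs kappa) (X : T -> U1) (Y : T -> U2) (k : nat)
    (f : 'I_k -> H) : Prop :=
  cond_independent P (sigma_of X f) X Y /\
  forall (k' : nat) (g : 'I_k' -> H),
    cond_independent P (sigma_of X g) X Y -> sigma_of X f `<=` sigma_of X g.

Definition dense_mod_constants (d d' : measure_display)
    (T : measurableType d) (U : measurableType d') (R : realType)
    (P : probability T R) (kappa : U -> U -> R) (H : rkhs kappa)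
    (X : {RV P >-> U}) : Prop :=
  (forall g : H, (rkhs_fun g : U -> R) \in Lfun (distribution P X) 2%:E) /\
  forall f : U -> R, f \in Lfun (distribution P X) 2%:E ->
    exists g : nat -> H,
      'V_P[fun w => rkhs_fun (g n) (X w) - f (X w)] @[n --> \oo] --> 0%E.

(* The kernel [K] is a regular conditional distribution of [X] given [Y]; as it
   is determined only up to a [P_Y]-null set of [y], some version is dominated. *)
Definition dominated_cond_distribution (d d1 d2 : measure_display)
    (T : measurableType d) (U1 : measurableType d1) (U2 : measurableType d2)
    (R : realType) (P : probability T R) (X : {RV P >-> U1})
    (Y : {RV P >-> U2}) : Prop :=
  exists K : R.-pker U2 ~> U1,
    (forall A B, measurable A -> measurable B ->
       P (X @^-1` A `&` Y @^-1` B) =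
       (\int[distribution P Y]_(y in B) K y A)%E) /\
    exists nu : {measure set U1 -> \bar R},
      sigma_finite setT nu /\ forall y, K y `<< nu.

(* [u_j] and [v_j] are of the same exact order: for positive sequences this says
   that [u_j / v_j] and [v_j / u_j] are bounded. *)
Definition same_order (R : realType) (u v : nat -> R) : Prop :=
  exists c C : R, [/\ 0 < c, 0 < C & forall j, c * v j <= u j <= C * v j].

(* [Z_n = O_p(a_n)], with the event [a_n M < Z_n] covered by a measurable one
   so that measurability of [Z_n] need not be known beforehand; for measurable
   [Z_n] this is the usual definition. *)
Definition Op (d : measure_display) (T : measurableType d) (R : realType)
    (P : probability T R) (Z : nat -> T -> \bar R) (a : nat -> R) : Prop :=
  forall eta : R, 0 < eta -> exists M : R, 0 < M /\
    \forall n \near \oo, exists E : set T,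
      [/\ measurable E, [set w | ((M * a n)%:E < Z n w)%E] `<=` E &
          (P E <= eta%:E)%E].

(* Main.v *)
Require Import Defs.
From HB Require Import structures.
From mathcomp Require Import all_boot all_order all_algebra.
From mathcomp Require Import all_classical all_reals all_analysis.
From mathcomp Require Import measurable_realfun.
From mathcomp Require Import ring lra.

Set Implicit Arguments.
Unset Strict Implicit.
Unset Printing Implicit Defensive.

Import Order.TTheory GRing.Theory Num.Theory.
Import numFieldNormedType.Exports.

Local Open Scope classical_set_scope.
Local Open Scope ring_scope.

(** Let [A] and [C] be the covariance operator of [X] and the cross-covariance
    operator, [An] and [Cn] their empirical versions, [e] the regularization,
    [Rg] the regression operator and [Rn = (An + e)^-1 Cn] its estimator. The
    inclusion of ranges gives the normal equation [A Rg = C], hence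
      [(An + e) (Rn - Rg) = (Cn - C) - (An - A) Rg - e Rg].
    If [z] solves the same equation with [A + e] on the left, replacing [A] by
    [An] costs [(An + e)^-1 (An - A) z], so that
      [|Rn - Rg| <= (1 + |An - A| / e) |z|]
    ([regularized_error]). The factor [1 / e] thus only meets the product of two
    small quantities, and the four terms of the rate are the products of [1] and
    [|An - A| / e] with the two parts of [z].

    The bias [e (A + e)^-1 Rg] is deterministic. In an eigenbasis [phi j] of [A],
    the smoothness assumption says that [Rg] is [A ^ beta S], and
    [e l ^ beta / (l + e)] is of order [e ^ min(beta, 1)] uniformly over the
    eigenvalues [l] ([source_bound]); for [beta > 1] the gain stops at [e].

    The stochastic part [(A + e)^-1 (Cn - C - (An - A) Rg)] is bounded in
    coordinates ([sample_cross_concentration]): the coordinate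
    [dot (phi j) ((Cn - C) g)] is [dot t g] where [t] is, up to the recentring of
    the sample, a centred average of [n] independent vectors whose second moment
    is at most a constant times the eigenvalue [lam j]. Summing [|t| ^ 2] with weights
    [(lam j + e) ^ -2] and taking expectations gives
    [sum_j lam j / (lam j + e) ^ 2 / n], which the polynomial decay of the
    eigenvalues bounds by [e ^ (- 1 / alpha - 1) / n] ([effective_dimension]).
    With weights [1] the same argument bounds [|An - A|] by [n ^ (- 1 / 2)], the
    trace being finite as [alpha > 1]. Markov's inequality concludes.

    Norms are controlled by coordinates only on the orthogonal complement of the
    kernel of [A] ([parseval_le]). The centred features lie there almost surely
    ([kernel_null_event]); this needs an argument because the Hilbert space is
    not assumed separable.

    The operators being defined by Bochner integrals, everything rests on the
    weak identities [dot f (C g) = E (dot f u * dot v g)]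
    ([dot_cross_bochner]). The integrals exist because a continuous bounded
    kernel on a subset of a Euclidean space has a strongly measurable feature
    map ([feature_bsm]). Limits of maps of finite range also give independence
    of Hilbert-valued functions of the sample ([expect_dot_indep]) without
    product measures. *)

(** * Inner products and coercive equations *)

Lemma cvgn_le (R : realType) (u : nat -> R) (l c : R) :
  u @ \oo --> l -> (forall n, u n <= c) -> l <= c.
Proof.
by move=> ul uc; apply: (ler_cvg_to ul (cvg_cst c)); exact: nearW.
Qed.

Section inner_product.
Context {R : realType} {H : hilbertType R}.
Implicit Types (u v w : H) (a : R).

Lemma dotDl u v w : dot (u + v) w = dot u w + dot v w.
Proof. by have := dot_linearl 1 u v w; rewrite scale1r mul1r. Qed.

Lemma dot0l w : dot 0 w = 0 :> R.
Proof. by have := dotDl 0 0 w; rewrite addr0; lra. Qed.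

Lemma dotZl a u w : dot (a *: u) w = a * dot u w.
Proof. by have := dot_linearl a u 0 w; rewrite addr0 dot0l addr0. Qed.

Lemma dotNl u w : dot (- u) w = - dot u w.
Proof. by rewrite -scaleN1r dotZl mulN1r. Qed.

Lemma dotBl u v w : dot (u - v) w = dot u w - dot v w.
Proof. by rewrite dotDl dotNl. Qed.

Lemma dotDr u v w : dot w (u + v) = dot w u + dot w v.
Proof. by rewrite !(dotC w) dotDl. Qed.

Lemma dot0r w : dot w 0 = 0 :> R.
Proof. by rewrite dotC dot0l. Qed.

Lemma dotZr a u w : dot w (a *: u) = a * dot w u.
Proof. by rewrite !(dotC w) dotZl. Qed.

Lemma dotNr u w : dot w (- u) = - dot w u.
Proof. by rewrite !(dotC w) dotNl. Qed.

Lemma dotBr u v w : dot w (u - v) = dot w u - dot w v.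
Proof. by rewrite dotDr dotNr. Qed.

Lemma dot_suml I (s : seq I) (Q : pred I) (F : I -> H) w :
  dot (\sum_(i <- s | Q i) F i) w = \sum_(i <- s | Q i) dot (F i) w.
Proof.
by apply: (big_morph (fun u => dot u w)) => [u v|]; rewrite ?dot0l ?dotDl.
Qed.

Lemma dot_sumr I (s : seq I) (Q : pred I) (F : I -> H) w :
  dot w (\sum_(i <- s | Q i) F i) = \sum_(i <- s | Q i) dot w (F i).
Proof. by rewrite dotC dot_suml; apply: eq_bigr => i _; rewrite dotC. Qed.

Lemma dot_ge0 u : 0 <= dot u u.
Proof. by rewrite dot_norm sqr_ge0. Qed.

Lemma norm2D u v : `|u + v| ^+ 2 = `|u| ^+ 2 + 2 * dot u v + `|v| ^+ 2.
Proof. by rewrite -!dot_norm dotDl !dotDr (dotC v u); ring. Qed.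

Lemma norm2B u v : `|u - v| ^+ 2 = `|u| ^+ 2 - 2 * dot u v + `|v| ^+ 2.
Proof. by rewrite norm2D dotNr normrN; ring. Qed.

Lemma cauchy_schwarz u v : `|dot u v| <= `|u| * `|v|.
Proof.
have [->|v0] := eqVneq v 0; first by rewrite dot0r !normr0 mulr0.
have v2 : 0 < `|v| ^+ 2 by rewrite exprn_gt0 ?normr_gt0.
rewrite -(@ler_pXn2r _ 2) ?nnegrE ?mulr_ge0 // exprMn real_normK ?num_real //.
have := dot_ge0 (u - (dot u v / `|v| ^+ 2) *: v).
rewrite dot_norm norm2B dotZr normrZ exprMn real_normK ?num_real // => h.
have : 0 <= (`|u| ^+ 2 - dot u v ^+ 2 / `|v| ^+ 2) * `|v| ^+ 2.
  apply: mulr_ge0; last exact: ltW.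
  suff <- : `|u| ^+ 2 - 2 * (dot u v / `|v| ^+ 2 * dot u v) +
      (dot u v / `|v| ^+ 2) ^+ 2 * `|v| ^+ 2 = `|u| ^+ 2 - dot u v ^+ 2 / `|v| ^+ 2.
    by [].
  by field; rewrite normr_eq0.
rewrite mulrBl divfK ?gt_eqF //; lra.
Qed.

Lemma dot_le u v : dot u v <= `|u| * `|v|.
Proof. exact: le_trans (ler_norm _) (cauchy_schwarz u v). Qed.

Lemma dot_inj u v : (forall w, dot w u = dot w v) -> u = v.
Proof.
move=> h; apply/eqP; rewrite -subr_eq0 -normr_eq0 -sqrf_eq0 -dot_norm.
by rewrite dotBr !h subrr.
Qed.

Lemma norm_le_dot (c : R) u :
  0 <= c -> (forall w, dot w u <= c * `|w|) -> `|u| <= c.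
Proof.
move=> c0 /(_ u); rewrite dot_norm expr2.
have [->|u0] := eqVneq u 0; first by rewrite normr0.
by rewrite ler_pM2r // normr_gt0.
Qed.

Lemma cvg_dot (T : Type) (F : set_system T) {FF : Filter F} (f g : T -> H) u v :
  f @ F --> u -> g @ F --> v -> (fun x => dot (f x) (g x)) @ F --> dot u v.
Proof.
move=> fu gv; have eqdot (x y : H) :
    dot x y = 2^-1 * (`|x + y| ^+ 2 - `|x| ^+ 2 - `|y| ^+ 2).
  by rewrite norm2D; field.
rewrite eqdot; under eq_cvg do rewrite eqdot.
apply: cvgMr; apply: cvgB; first apply: cvgB.
- by rewrite expr2; under eq_cvg do rewrite expr2; apply: cvgM; apply: cvg_norm; exact: cvgD.
- by rewrite expr2; under eq_cvg do rewrite expr2; apply: cvgM; apply: cvg_norm.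
- by rewrite expr2; under eq_cvg do rewrite expr2; apply: cvgM; apply: cvg_norm.
Qed.

End inner_product.

Section linear_maps.
Context {R : realType} {E F : normedModType R} (A : E -> F) (Alin : linear A).

Lemma lin0 : A 0 = 0.
Proof. by have := Alin (-1) 0 0; rewrite scaler0 addr0 scaleN1r addNr. Qed.

Lemma linD x y : A (x + y) = A x + A y.
Proof. by have := Alin 1 x y; rewrite !scale1r. Qed.

Lemma linZ a x : A (a *: x) = a *: A x.
Proof. by have := Alin a x 0; rewrite lin0 !addr0. Qed.

Lemma linN x : A (- x) = - A x.
Proof. by rewrite -scaleN1r linZ scaleN1r. Qed.

Lemma linB x y : A (x - y) = A x - A y.
Proof. by rewrite linD linN. Qed.

End linear_maps.

(** Since [A + e] is [e]-coercive and bounded, [x |-> x - t (A x + e x - y)] is a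
    contraction as soon as [t] is small; its fixed point solves the equation. *)
Lemma coercive_surj (R : realType) (H : hilbertType R) (A : H -> H) (M e : R) :
  linear A -> (forall x, `|A x| <= M * `|x|) -> (forall x, 0 <= dot x (A x)) ->
  0 < e -> forall y, exists x, A x + e *: x = y.
Proof.
move=> Alin AM Apos e0 y.
pose L := `|M| + e.
have L0 : 0 < L by rewrite ltr_wpDl.
have BL x : `|A x + e *: x| <= L * `|x|.
  rewrite (le_trans (ler_normD _ _)) // mulrDl normrZ (gtr0_norm e0) lerD2r.
  by rewrite (le_trans (AM x)) // ler_wpM2r // ler_norm.
pose t := e / L ^+ 2.
have t0 : 0 < t by rewrite divr_gt0 // exprn_gt0.
pose f x := x - t *: (A x + e *: x - y).
have eL : e <= L by rewrite lerDr.
have q0 : 0 <= 1 - (e / L) ^+ 2.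
  rewrite subr_ge0 exprn_ile1 //; first by rewrite divr_ge0 // ltW.
  by rewrite ler_pdivrMr // mul1r.
have fdist x z : `|f x - f z| <= Num.sqrt (1 - (e / L) ^+ 2) * `|x - z|.
  have -> : f x - f z = (x - z) - t *: (A (x - z) + e *: (x - z)).
    have -> : A (x - z) + e *: (x - z) = (A x + e *: x) - (A z + e *: z).
      by rewrite (linB Alin) scalerBr opprD addrACA.
    rewrite /f !(scalerBr t) !opprD !opprK !addrA.
    by rewrite [LHS](ACl (1*4*2*5*3*6))/= addrK.
  set d := x - z.
  rewrite -(@ler_pXn2r _ 2) ?nnegrE ?mulr_ge0 ?sqrtr_ge0 //.
  rewrite exprMn sqr_sqrtr // norm2B dotZr dotDr dotZr dot_norm normrZ exprMn.
  rewrite real_normK ?num_real //.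
  have h1 : `|A d + e *: d| ^+ 2 <= L ^+ 2 * `|d| ^+ 2.
    by rewrite -exprMn lerXn2r ?nnegrE ?mulr_ge0 ?(ltW L0).
  have h2 := Apos d.
  have h3 : t ^+ 2 * `|A d + e *: d| ^+ 2 <= t ^+ 2 * (L ^+ 2 * `|d| ^+ 2).
    by rewrite ler_wpM2l // sqr_ge0.
  have h4 : 0 <= t * dot d (A d) by rewrite mulr_ge0 // ltW.
  have h5 : t ^+ 2 * (L ^+ 2 * `|d| ^+ 2) = t * e * `|d| ^+ 2.
    by rewrite /t; field; rewrite gt_eqF.
  have -> : (1 - (e / L) ^+ 2) * `|d| ^+ 2 = `|d| ^+ 2 - t * e * `|d| ^+ 2.
    by rewrite /t; field; rewrite gt_eqF.
  by move: h3 h4; rewrite h5; lra.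
have fT : set_fun [set: H] [set: H] f by [].
pose ff : {fun [set: H] >-> [set: H]} := HB.pack f (isFun.Build _ _ _ _ _ fT).
have [] := @banach_fixed_point R H setT ff.
- exists (NngNum (sqrtr_ge0 (1 - (e / L) ^+ 2))); split => /=.
    rewrite -[ltRHS]sqrtr1 ltr_sqrt // ltrBlDr ltrDl exprn_gt0 // divr_gt0 //.
  by move=> [x z] _ /=; exact: fdist.
- exact: closedT.
- by exists 0.
move=> x _; rewrite /ff/= /f => /eqP; rewrite -subr_eq0 opprB addrCA subrr addr0.
rewrite scaler_eq0 gt_eqF //= subr_eq0 => /eqP; by exists x.
Qed.

(** * Spectral decomposition of a positive operator *)

Section spectral.
Context {R : realType} {H : hilbertType R}.
Variables (A : H -> H) (lam : nat -> R) (phi : nat -> H) (M : R).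
Hypothesis Alin : linear A.
Hypothesis AM : forall x, `|A x| <= M * `|x|.
Hypothesis Asym : forall x y, dot x (A y) = dot (A x) y.
Hypothesis Aspec : spectral_decomposition A lam phi.

Let orth i j : 0 < lam i -> 0 < lam j -> dot (phi i) (phi j) = (i == j)%:R.
Proof. by case: Aspec => _ + _ _; exact. Qed.

Let eig j : A (phi j) = lam j *: phi j.
Proof. by case: Aspec => _ _ + _; exact. Qed.

Lemma norm_eigvec j : 0 < lam j -> `|phi j| = 1.
Proof.
move=> lj; have := orth lj lj; rewrite dot_norm eqxx => /eqP.
by rewrite -[X in _ == X](expr1n _ 2) eqrXn2 // => /eqP.
Qed.

Lemma ker_orth_eigvec f j : A f = 0 -> 0 < lam j -> dot f (phi j) = 0.
Proof.
move=> Af lj; have := Asym f (phi j); rewrite eig Af dot0l dotZr => /eqP.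
by rewrite mulf_eq0 gt_eqF //= => /eqP.
Qed.

Definition eigen_sum (y : H) (m : nat) : H :=
  \sum_(0 <= j < m | 0 < lam j) dot (phi j) y *: phi j.

Lemma dot_eigvec_sum y i m : 0 < lam i ->
  dot (phi i) (eigen_sum y m) = if (i < m)%N then dot (phi i) y else 0.
Proof.
move=> li; rewrite /eigen_sum dot_sumr.
rewrite (eq_bigr (fun j => if j == i then dot (phi i) y else 0)); last first.
  move=> j lj; rewrite dotZr orth // eq_sym; case: eqVneq => [->|_].
    by rewrite mulr1.
  by rewrite mulr0.
rewrite -big_mkcondr /=.
case: ltnP => im; last first.
  rewrite big_nat_cond big1 // => j /andP[/andP[_ jm] /andP[_ /eqP ji]].
  by move: jm; rewrite ji ltnNge im.
rewrite (big_cat_nat (n := i)) //=; last exact: ltnW.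
rewrite big_nat_cond big1 ?add0r; last first.
  by move=> j /andP[/andP[_ ji] /andP[_ /eqP e]]; move: ji; rewrite e ltnn.
rewrite big_ltn_cond // li eqxx /= big_nat_cond big1 ?addr0 //.
by move=> j /andP[/andP[ij _] /andP[_ /eqP e]]; move: ij; rewrite e ltnn.
Qed.

Lemma dot_eigen_sum y z m :
  dot (eigen_sum y m) z = \sum_(0 <= j < m | 0 < lam j) dot (phi j) y * dot (phi j) z.
Proof. by rewrite dot_suml; apply: eq_bigr => j _; rewrite dotZl. Qed.

Lemma dot_eigen_sum2 y m n : (m <= n)%N ->
  dot (eigen_sum y m) (eigen_sum y n) = `|eigen_sum y m| ^+ 2.
Proof.
move=> mn; rewrite -dot_norm !dot_eigen_sum [LHS]big_nat_cond [RHS]big_nat_cond.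
apply: eq_bigr => j /andP[/andP[_ jm] lj].
by rewrite !dot_eigvec_sum // jm (leq_trans jm).
Qed.

Lemma norm_eigen_sum y m :
  `|eigen_sum y m| ^+ 2 = \sum_(0 <= j < m | 0 < lam j) dot (phi j) y ^+ 2.
Proof.
rewrite -dot_norm !dot_eigen_sum [LHS]big_nat_cond [RHS]big_nat_cond.
apply: eq_bigr => j /andP[/andP[_ jm] lj].
by rewrite dot_eigvec_sum // jm expr2.
Qed.

Lemma bessel y m : `|eigen_sum y m| ^+ 2 <= `|y| ^+ 2.
Proof.
have : 0 <= `|y - eigen_sum y m| ^+ 2 by rewrite sqr_ge0.
have : dot y (eigen_sum y m) = `|eigen_sum y m| ^+ 2.
  by rewrite dotC dot_eigen_sum norm_eigen_sum; apply: eq_bigr => j _; rewrite expr2.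
by rewrite norm2B => ->; lra.
Qed.

(** The squared norms of the partial sums increase and are bounded by Bessel's
    inequality, and their increments are the squared distances. *)
Lemma eigen_sum_is_cvg y : cvgn (eigen_sum y).
Proof.
pose r m := `|eigen_sum y m| ^+ 2.
have rnd : nondecreasing_seq r.
  apply/nondecreasing_seqP => n; rewrite /r !norm_eigen_sum.
  rewrite [leRHS](big_cat_nat (n := n)) //= lerDl.
  by apply: sumr_ge0 => j _; rewrite sqr_ge0.
have rc : cvgn r.
  apply: nondecreasing_is_cvgn => //.
  by exists (`|y| ^+ 2) => _ [n _ <-]; exact: bessel.
have dist m n : (m <= n)%N ->
    `|eigen_sum y m - eigen_sum y n| ^+ 2 = r n - r m.
  by move=> mn; rewrite norm2B dot_eigen_sum2 // /r; ring.
apply/cauchy_cvgP; apply/cauchy_ballP => e e0; near_simpl.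
have e2 : 0 < e ^+ 2 by rewrite exprn_gt0.
have /cvgrPdist_lt /(_ (e ^+ 2) e2) [N _ hN] := rc.
exists ([set n | (N <= n)%N], [set n | (N <= n)%N]); first by split; exists N.
have lt_main m n : (m <= n)%N -> (N <= m)%N ->
    `|eigen_sum y m - eigen_sum y n| < e.
  move=> mn Nm; rewrite -(@ltr_pXn2r _ 2) ?nnegrE ?(ltW e0) // dist //.
  have h : r n <= limn r by exact: nondecreasing_cvgn_le.
  have := hN m Nm; rewrite /= ger0_norm ?subr_ge0; last exact: nondecreasing_cvgn_le.
  by apply: le_lt_trans; rewrite lerD2r.
move=> [m n] [/= Nm Nn]; rewrite -ball_normE /=.
by case/orP: (leq_total m n) => [mn|nm]; [|rewrite distrC]; exact: lt_main.
Qed.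

Definition eigen_proj (y : H) : H := limn (eigen_sum y).

Lemma eigen_sum_cvg y : eigen_sum y @ \oo --> eigen_proj y.
Proof. exact: eigen_sum_is_cvg. Qed.
Arguments eigen_sum_cvg : clear implicits.

Lemma ker_orth_proj f y : A f = 0 -> dot f (eigen_proj y) = 0.
Proof.
move=> Af; have : (fun n => dot f (eigen_sum y n)) @ \oo --> (0 : R).
  apply: cvg_near_cst; near=> n; rewrite dot_sumr big1 // => j lj.
  by rewrite dotZr ker_orth_eigvec // mulr0.
have h : dot f (eigen_sum y n) @[n --> \oo] --> dot f (eigen_proj y).
  exact: cvg_dot (cvg_cst f) (eigen_sum_cvg y).
by move=> h2; exact: (cvg_unique (@Rhausdorff R) h h2).
Unshelve. all: by end_near. Qed.

Lemma eigvec_proj y i : 0 < lam i -> dot (phi i) (eigen_proj y) = dot (phi i) y.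
Proof.
move=> li; have : (fun n => dot (phi i) (eigen_sum y n)) @ \oo --> (dot (phi i) y : R).
  apply: cvg_near_cst; near=> n; rewrite dot_eigvec_sum // ifT //.
  by near: n; exact: nbhs_infty_gt.
have h : dot (phi i) (eigen_sum y n) @[n --> \oo] --> dot (phi i) (eigen_proj y).
  exact: cvg_dot (cvg_cst (phi i)) (eigen_sum_cvg y).
by move=> h2; exact: (cvg_unique (@Rhausdorff R) h h2).
Unshelve. all: by end_near. Qed.

Lemma ker_coproj y : A (y - eigen_proj y) = 0.
Proof.
case: Aspec => _ _ _; apply => j lj.
by rewrite dotBr eigvec_proj // subrr.
Qed.

Lemma A_proj y : A (eigen_proj y) = A y.
Proof. by apply/esym/eqP; rewrite -subr_eq0 -(linB Alin) ker_coproj. Qed.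

Lemma pythagoras y : `|y| ^+ 2 = `|y - eigen_proj y| ^+ 2 + `|eigen_proj y| ^+ 2.
Proof.
have := norm2D (y - eigen_proj y) (eigen_proj y).
by rewrite subrK ker_orth_proj ?ker_coproj // mulr0 addr0.
Qed.

Lemma coproj_le y : `|y - eigen_proj y| <= `|y|.
Proof.
by rewrite -(@ler_pXn2r _ 2) ?nnegrE // [leRHS]pythagoras lerDl sqr_ge0.
Qed.

Lemma eigen_projB y z : eigen_proj (y - z) = eigen_proj y - eigen_proj z.
Proof.
apply: cvg_lim => //.
rewrite (_ : eigen_sum (y - z) = eigen_sum y \- eigen_sum z).
  exact: cvgB (eigen_sum_cvg y) (eigen_sum_cvg z).
apply/funext => m; rewrite /eigen_sum /= -sumrB; apply: eq_bigr => j _.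
by rewrite dotBr scalerBl.
Qed.

Lemma proj_orth f y : A f = 0 -> dot f (y - eigen_proj y) = dot f y.
Proof. by move=> Af; rewrite dotBr ker_orth_proj // subr0. Qed.

(** The residual [y - eigen_proj y] is in the kernel, hence orthogonal both to
    [y] and to [eigen_proj y]: it is orthogonal to itself. *)
Lemma proj_id y : (forall f, A f = 0 -> dot f y = 0) -> eigen_proj y = y.
Proof.
move=> Vy; apply/eqP; rewrite eq_sym -subr_eq0 -normr_eq0 -sqrf_eq0 -dot_norm.
by rewrite proj_orth ?ker_coproj // Vy // ker_coproj.
Qed.

(** Coordinates in the eigenvectors control the norm only on the orthogonal
    complement of the kernel. *)
Lemma parseval_le y (c : R) : (forall f, A f = 0 -> dot f y = 0) ->
  (forall m, \sum_(0 <= j < m | 0 < lam j) dot (phi j) y ^+ 2 <= c) ->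
  `|y| ^+ 2 <= c.
Proof.
move=> Vy yc; have h : `|eigen_sum y n| @[n --> \oo] --> `|y|.
  by apply: cvg_norm; rewrite -[X in _ --> X]proj_id //; exact: eigen_sum_cvg.
rewrite expr2; apply: (cvgn_le (cvgM h h)) => m /=.
by rewrite -expr2 norm_eigen_sum.
Qed.

Hypothesis Apos : forall x, 0 <= dot x (A x).

Lemma eigval_le j : 0 < lam j -> lam j <= M.
Proof.
move=> lj; have := AM (phi j); rewrite eig normrZ norm_eigvec // !mulr1.
by rewrite gtr0_norm.
Qed.

(** The equation is solved by coercivity; its solution is again orthogonal to the
    kernel, so the coordinates [(lam j + e)^-1 * dot (phi j) y] bound its norm. *)
Lemma resolvent_bound (e c : R) y : 0 < e -> 0 <= c ->
  (forall f, A f = 0 -> dot f y = 0) ->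
  (forall m, \sum_(0 <= j < m | 0 < lam j)
     ((lam j + e)^-1 * dot (phi j) y) ^+ 2 <= c ^+ 2) ->
  exists2 z, A z + e *: z = y & `|z| <= c.
Proof.
move=> e0 c0 Vy yc; have [z Az] := coercive_surj Alin AM Apos e0 y.
exists z => //; rewrite -(@ler_pXn2r _ 2) ?nnegrE //.
apply: parseval_le => [f Af|m].
  have := Vy f Af; rewrite -Az dotDr Asym Af dot0l add0r dotZr => /eqP.
  by rewrite mulf_eq0 gt_eqF //= => /eqP.
apply: le_trans (yc m); rewrite le_eqVlt; apply/orP; left; apply/eqP.
apply: eq_bigr => j lj; congr (_ ^+ 2).
rewrite -Az dotDr Asym eig dotZl dotZr -mulrDl mulKf //.
by rewrite gt_eqF // addr_gt0.
Qed.

(** For [b <= 1], compare [l ^ b] with [e ^ b] when [l <= e], and [e ^ (1 - b)]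
    with [l ^ (1 - b)] otherwise; for [b > 1] the factor [l ^ (b - 1)] is bounded by
    [M ^ (b - 1)]. *)
Lemma filter_bound (e b : R) (l : R) : 0 < e -> 0 < b -> 0 < l -> l <= M ->
  e * l `^ b <= (1 + M `^ (b - 1)) * e `^ (Num.min b 1) * (l + e).
Proof.
move=> e0 b0 l0 lM; have M0 := lt_le_trans l0 lM.
have powS (x : R) : 0 < x -> x `^ b = x * x `^ (b - 1).
  by move=> x0; rewrite -{2}(powRr1 (ltW x0)) -powRD ?subrKC // gt_eqF ?implybT.
case: (leP b 1) => b1.
- apply: (@le_trans _ _ (1 * e `^ b * (l + e))); last first.
    rewrite ler_wpM2r ?ler_wpM2r ?powR_ge0 ?addr_ge0 ?(ltW l0) ?(ltW e0) //.
    by rewrite lerDl powR_ge0.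
  rewrite mul1r; case: (leP l e) => le.
    rewrite mulrC ler_pM ?powR_ge0 ?(ltW e0) //; last by rewrite lerDr ltW.
    by rewrite ge0_ler_powR ?nnegrE ?(ltW l0) ?(ltW e0) ?(ltW b0).
  apply: (@le_trans _ _ (e `^ b * l)); last first.
    by rewrite ler_wpM2l ?powR_ge0 // lerDl ltW.
  have split1 (x : R) : 0 < x -> x = x `^ b * x `^ (1 - b).
    by move=> x0; rewrite -powRD ?subrKC ?powRr1 ?ltW // gt_eqF ?implybT.
  rewrite {1}(split1 e) // {2}(split1 l) // -mulrA ler_wpM2l ?powR_ge0 //.
  rewrite mulrC ler_wpM2l ?powR_ge0 //.
  by rewrite ge0_ler_powR ?nnegrE ?(ltW l0) ?(ltW e0) ?subr_ge0 // ltW.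
- rewrite powRr1 ?(ltW e0) // powS // mulrCA (mulrC (1 + _)) -mulrA mulrCA.
  rewrite ler_pM2l // mulrC ler_pM ?powR_ge0 ?(ltW l0) //.
    apply: (@le_trans _ _ (M `^ (b - 1))); last by rewrite lerDr.
    by rewrite ge0_ler_powR ?nnegrE ?(ltW l0) ?(ltW M0) ?subr_ge0 // ltW.
  by rewrite lerDl ltW.
Qed.

(** Source condition: an element that is [A ^ b s] in the eigenbasis is
    approximated by its Tikhonov regularization at the rate [e ^ min(b, 1)];
    [z] is the error of approximation. *)
Lemma source_bound (e b : R) (r s : H) : 0 < e -> 0 < b ->
  (forall f, A f = 0 -> dot f r = 0) ->
  (forall j, 0 < lam j -> dot (phi j) r = lam j `^ b * dot (phi j) s) ->
  exists2 z, A z + e *: z = e *: r &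
    `|z| <= (1 + M `^ (b - 1)) * e `^ (Num.min b 1) * `|s|.
Proof.
move=> e0 b0 Vr rs; set C := (1 + _) * _.
have C0 : 0 <= C by rewrite mulr_ge0 ?powR_ge0 // addr_ge0 ?powR_ge0.
apply: resolvent_bound => //; first by rewrite mulr_ge0.
- by move=> f Af; rewrite dotZr Vr // mulr0.
- move=> m; apply: (@le_trans _ _ (C ^+ 2 * `|eigen_sum s m| ^+ 2)).
    rewrite norm_eigen_sum mulr_sumr; apply: ler_sum => j lj.
    have -> : (lam j + e)^-1 * dot (phi j) (e *: r) =
        (lam j + e)^-1 * e * lam j `^ b * dot (phi j) s.
      by rewrite dotZr rs // !mulrA.
    rewrite [leLHS]exprMn ler_wpM2r ?sqr_ge0 // lerXn2r ?nnegrE //.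
      by rewrite !mulr_ge0 ?invr_ge0 ?addr_ge0 ?powR_ge0 ?(ltW lj) ?(ltW e0).
    rewrite -mulrA mulrC ler_pdivrMr ?addr_gt0 //.
    exact: filter_bound (eigval_le lj).
  by rewrite [leRHS]exprMn ler_wpM2l ?sqr_ge0 // bessel.
Qed.

End spectral.

(** * Sums over the spectrum *)

(** Otherwise the matrix of coordinates of the [phi i] would have more rows than
    columns, and a nonzero vector of its left kernel would give a vanishing
    combination of orthonormal vectors. *)
Lemma orthonormal_size (R : realType) (H : hilbertType R) (W : set H)
    (phi : nat -> H) (J : seq nat) (n : nat) :
  has_dim W n -> (forall i, i \in J -> W (phi i)) ->
  {in J &, forall i j, dot (phi i) (phi j) = (i == j)%:R} -> uniq J ->
  (size J <= n)%N.
Proof.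
move=> [e [_ We]] WJ orth uJ; rewrite leqNgt; apply/negP => nJ.
pose k := size J.
have mem (i : 'I_k) : nth 0%N J i \in J by rewrite mem_nth.
have /choice[c hc] : forall i : 'I_k, exists c : 'I_n -> R,
    phi (nth 0%N J i) = \sum_l c l *: e l.
  by move=> i; have := WJ _ (mem i); rewrite We.
pose C : 'M[R]_(k, n) := \matrix_(i, l) c i l.
have : kermx C != 0.
  by rewrite -mxrank_eq0 mxrank_ker subn_eq0 -ltnNge (leq_ltn_trans (rank_leq_col _)).
case/rowV0Pn => v /sub_kermxP vC0 v0.
have sum0 : \sum_(i < k) v ord0 i *: phi (nth 0%N J i) = 0.
  under eq_bigr do rewrite hc scaler_sumr.
  rewrite exchange_big big1 // => l _.
  under eq_bigr do rewrite scalerA.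
  rewrite -scaler_suml (_ : \sum_i _ = (v *m C) ord0 l).
    by rewrite vC0 mxE scale0r.
  by rewrite mxE; apply: eq_bigr => i _; rewrite mxE.
case/eqP: v0; apply/rowP => i; rewrite mxE.
have := dot0r (phi (nth 0%N J i)); rewrite -sum0 dot_sumr (bigD1 i) //=.
rewrite dotZr orth // eqxx mulr1 big1 ?addr0 // => l li.
rewrite dotZr orth // nth_uniq //.
by move: li; rewrite eq_sym -val_eqE => /negbTE ->; rewrite mulr0.
Qed.

(** Both [lam] and [lambda] list the positive eigenvalues, but the order of the
    spectral decomposition is arbitrary; the comparison of multiplicities makes
    each finite part of it a sub-multiset of an initial segment of the other. *)
Lemma sum_spectrum_le (R : realType) (H : hilbertType R) (A : H -> H)
    (lam lambda : nat -> R) (phi : nat -> H) (g : R -> R) (C : R) :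
  spectral_decomposition A lam phi -> eigenvalues A lambda ->
  (forall i, 0 < lambda i) -> (forall x, 0 < x -> 0 <= g x) ->
  (forall N, \sum_(0 <= i < N) g (lambda i) <= C) ->
  forall m, \sum_(0 <= j < m | 0 < lam j) g (lam j) <= C.
Proof.
move=> [_ orth eig _] [_ mult] lambda0 g0 gC m.
pose lambdas N := [seq lambda i | i <- iota 0 N].
have mult_le t : 0 < t -> exists N, forall J : seq nat, uniq J ->
    (forall j, j \in J -> lam j = t) -> (size J <= count_mem t (lambdas N))%N.
  move=> t0; have [n [dimn cardn]] := mult t (lt0r_neq0 t0).
  have fin : finite_set [set j | lambda j = t] by apply/finite_setP; exists n.
  pose s : seq nat := finmap.enum_fset (fset_set [set j | lambda j = t]).
  have sE i : (i \in s) = (lambda i == t).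
    by rewrite in_fset_set //; apply/idP/eqP; rewrite inE.
  have us : uniq s by exact: finmap.fset_uniq.
  exists (\max_(i <- s) i).+1 => J uJ Jt.
  have Jn : (size J <= n)%N.
    apply: (orthonormal_size dimn (phi := phi)) uJ => //.
      by move=> i /Jt lit /=; rewrite eig lit.
    by move=> i j /Jt li /Jt lj; apply: orth; rewrite ?li ?lj.
  rewrite (leq_trans Jn) // -(card_fset_set cardn) -/s count_map -size_filter.
  apply: uniq_leq_size => // i is_; rewrite mem_filter mem_iota add0n ltnS.
  by rewrite [preim _ _ i]/= -sE is_; apply: leq_bigmax_seq.
have /choice[Nt hN] : forall t, exists N, 0 < t -> forall J : seq nat, uniq J ->
    (forall j, j \in J -> lam j = t) -> (size J <= count_mem t (lambdas N))%N.
  move=> t; case: (ltP 0 t) => [/mult_le[N hN]|_]; last by exists 0%N.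
  by exists N.
pose J := [seq j <- index_iota 0 m | 0 < lam j].
pose N := \max_(j <- J) Nt (lam j).
have lambdas_mono k l t : (k <= l)%N ->
    (count_mem t (lambdas k) <= count_mem t (lambdas l))%N.
  by move=> kl; rewrite /lambdas -(subnKC kl) iotaD map_cat count_cat leq_addr.
have /count_subseqP[s sub perm] t :
    (count_mem t [seq lam j | j <- J] <= count_mem t (lambdas N))%N.
  case: (boolP (t \in [seq lam j | j <- J])) => [|/count_memPn -> //].
  case/mapP => j jJ ->.
  apply: (@leq_trans (count_mem (lam j) (lambdas (Nt (lam j))))); last first.
    by apply: lambdas_mono; rewrite /N; apply: (leq_bigmax_seq (F := fun j => Nt (lam j))).
  have lj : 0 < lam j by move: jJ; rewrite mem_filter => /andP[].
  rewrite count_map -size_filter; apply: hN => //.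
    by rewrite filter_uniq // filter_uniq // iota_uniq.
  by move=> i; rewrite mem_filter => /andP[/eqP].
apply: le_trans (gC N).
rewrite -big_filter -/J -(big_map lam xpredT g) (perm_big _ perm) /=.
have /subseqP[b sb ->] := sub.
rewrite -(big_map lambda xpredT g) /index_iota subn0 -/(lambdas N).
have lpos x : x \in lambdas N -> 0 < x by case/mapP => i _ ->.
elim: (lambdas N) b sb lpos => [|x l IH] [|c b] //= [sb] lpos.
have {}IH : \sum_(i <- mask b l) g i <= \sum_(i <- l) g i.
  by apply: IH => // y yl; apply: lpos; rewrite inE yl orbT.
case: c; rewrite !big_cons ?lerD2l // ler_wpDl // g0 // lpos ?mem_head //.
Qed.

Section power_sums.
Context {R : realType} (alpha : R) (a1 : 1 < alpha).

Let am1 : 0 < alpha - 1. Proof. by rewrite subr_gt0. Qed.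
Let a0 : 0 < alpha. Proof. exact: lt_trans a1. Qed.

(** With [k = i + 1], this is [(1 - 1 / k) ^ (1 - alpha) >= 1 + (alpha - 1) / k],
    from [exp x >= 1 + x] and [ln (1 + x) <= x]. *)
Lemma powR_telescope (i : nat) : (0 < i)%N ->
  (alpha - 1) * i.+1%:R `^ (- alpha) <= i%:R `^ (1 - alpha) - i.+1%:R `^ (1 - alpha).
Proof.
move=> i0; set k : R := i.+1%:R.
have k0 : 0 < k by rewrite ltr0n.
have k1 : k^-1 < 1 by rewrite invf_lt1 // ltr1n.
have iE : i%:R = k * (1 - k^-1) :> R.
  by rewrite mulrBr mulr1 mulfV ?gt_eqF // /k -natr1 addrK.
have -> : k `^ (- alpha) = k `^ (1 - alpha) * k^-1.
  rewrite -(powR_inv1 (ltW k0)) -powRD; last by apply/implyP => _; rewrite gt_eqF.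
  by congr (_ `^ _); ring.
rewrite iE powRM ?(ltW k0) ?subr_ge0 ?(ltW k1) //.
suff : 1 + (alpha - 1) * k^-1 <= (1 - k^-1) `^ (1 - alpha).
  rewrite -subr_ge0 => h; have := mulr_ge0 (powR_ge0 k (1 - alpha)) h.
  rewrite -[in X in _ -> X]subr_ge0; congr (0 <= _); ring.
rewrite /powR gt_eqF ?subr_gt0 //; apply: le_trans (expR_ge1Dx _).
rewrite lerD2l -[1 - alpha]opprB mulNr -mulrN ler_pM2l // lerNr.
by rewrite le_ln1Dx // ltrN2.
Qed.

Lemma powR_tail (N M : nat) : (0 < N)%N ->
  \sum_(N <= i < M) i.+1%:R `^ (- alpha) <= N%:R `^ (1 - alpha) / (alpha - 1).
Proof.
move=> N0; rewrite ler_pdivlMr // mulrC mulr_sumr.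
case: (leqP M N) => [MN|/ltnW NM]; first by rewrite big_geq // powR_ge0.
apply: (@le_trans _ _ (\sum_(N <= i < M) - (i.+1%:R `^ (1 - alpha) - i%:R `^ (1 - alpha)))).
  rewrite big_nat_cond [leRHS]big_nat_cond; apply: ler_sum => i /andP[/andP[Ni _] _].
  by rewrite opprB powR_telescope // (leq_trans N0).
rewrite sumrN telescope_sumr // opprB.
by rewrite gerBl powR_ge0.
Qed.

Variables (lambda : nat -> R) (D : R).
Hypothesis lambda0 : forall i, 0 < lambda i.
Hypothesis lambdaD : forall i, lambda i <= D * i.+1%:R `^ (- alpha).

Let D0 : 0 < D.
Proof.
have := lt_le_trans (lambda0 0) (lambdaD 0).
by rewrite pmulr_lgt0 // powR_gt0.
Qed.

Lemma trace_bound N : \sum_(0 <= i < N) lambda i <= D * (1 + (alpha - 1)^-1).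
Proof.
apply: (@le_trans _ _ (\sum_(0 <= i < N) D * i.+1%:R `^ (- alpha))).
  by apply: ler_sum.
rewrite -mulr_sumr ler_pM2l //.
case: N => [|N]; first by rewrite big_geq // addr_ge0 // invr_ge0 ltW.
rewrite big_ltn // powR1 lerD2l (le_trans (powR_tail _ _)) //.
by rewrite powR1 mul1r.
Qed.

(** The indices up to [T = e ^ (- 1 / alpha)] contribute at most [1 / e] each,
    the remaining ones at most [lambda_i / e ^ 2], which sums to the same order. *)
Lemma effective_dimension (e : R) N : 0 < e -> e <= 1 ->
  \sum_(0 <= i < N) lambda i / (lambda i + e) ^+ 2 <=
  (1 + D * 2 `^ (alpha - 1) / (alpha - 1)) * e `^ (- ((alpha + 1) / alpha)).
Proof.
move=> e0 e1; pose T := e `^ (- alpha^-1).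
have T0 : 0 < T by rewrite powR_gt0.
have T1 : 1 <= T.
  rewrite /T powRN -[leLHS]invr1 lef_pV2 ?posrE ?powR_gt0 //.
  have : e `^ alpha^-1 <= 1 `^ alpha^-1.
    by rewrite ge0_ler_powR ?nnegrE ?invr_ge0 ?(ltW a0) ?(ltW e0).
  by rewrite powR1.
have ET : e `^ (- ((alpha + 1) / alpha)) = e^-1 * T.
  rewrite -(powR_inv1 (ltW e0)) -powRD; last by apply/implyP => _; rewrite gt_eqF.
  by congr (_ `^ _); field; rewrite gt_eqF.
have TE : T `^ (1 - alpha) = e * T.
  have -> : e * T = T * T `^ (- alpha).
    rewrite /T -powRrM mulrN mulNr opprK mulVf ?gt_eqF // powRr1 ?(ltW e0) //.
    by rewrite mulrC.
  by rewrite -{2}(powRr1 (ltW T0)) -powRD //; apply/implyP => _; rewrite gt_eqF.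
pose K := Num.trunc T.
have /andP[KT TK] : K%:R <= T < K.+1%:R by apply: truncn_itv; exact: ltW.
have K0 : (0 < K)%N by rewrite lt0n; apply: contraTN TK => /eqP ->; rewrite -leNgt.
have f0 i : 0 <= lambda i / (lambda i + e) ^+ 2.
  by rewrite divr_ge0 ?sqr_ge0 // ltW.
have small i : lambda i / (lambda i + e) ^+ 2 <= e^-1.
  have l0 := lambda0 i.
  rewrite ler_pdivrMr ?exprn_gt0 ?addr_gt0 // ler_pdivlMl //.
  by rewrite expr2 mulrDl !mulrDr; nra.
have large i : lambda i / (lambda i + e) ^+ 2 <= (e ^+ 2)^-1 * lambda i.
  rewrite mulrC ler_pM2r // lef_pV2 ?posrE ?exprn_gt0 ?addr_gt0 //.
  by rewrite lerXn2r ?nnegrE ?addr_ge0 ?(ltW e0) ?(ltW (lambda0 i)) // lerDr ltW.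
apply: (@le_trans _ _ (\sum_(0 <= i < K) lambda i / (lambda i + e) ^+ 2 +
                       \sum_(K <= i < N) lambda i / (lambda i + e) ^+ 2)).
  case: (leqP K N) => [KN|/ltnW NK]; first by rewrite (big_cat_nat (n := K)).
  rewrite [X in _ + X]big_geq // addr0 [leRHS](big_cat_nat (n := N)) //= lerDl.
  exact: sumr_ge0.
rewrite ET mulrDl mul1r lerD //.
  apply: (@le_trans _ _ (\sum_(0 <= i < K) e^-1)); first exact: ler_sum.
  by rewrite sumr_const_nat subn0 -mulr_natr ler_pM2l ?invr_gt0.
apply: (@le_trans _ _ ((e ^+ 2)^-1 * (D * \sum_(K <= i < N) i.+1%:R `^ (- alpha)))).
  rewrite mulr_sumr mulr_sumr; apply: ler_sum => i _; apply: le_trans (large i) _.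
  by rewrite ler_pM2l // invr_gt0 exprn_gt0.
have -> : D * 2 `^ (alpha - 1) / (alpha - 1) * (e^-1 * T) =
    (e ^+ 2)^-1 * (D * (2 `^ (alpha - 1) * T `^ (1 - alpha) / (alpha - 1))).
  by rewrite TE; field; rewrite !gt_eqF.
rewrite ler_pM2l ?invr_gt0 ?exprn_gt0 // ler_pM2l //.
apply: le_trans (powR_tail _ K0) _; rewrite ler_pM2r ?invr_gt0 //.
have halfT : T / 2 <= K%:R.
  rewrite ler_pdivrMr // (le_trans (ltW TK)) // -natr1 mulr_natr mulr2n lerD2l.
  by rewrite ler1n.
have -> : 2 `^ (alpha - 1) * T `^ (1 - alpha) = (T / 2) `^ (1 - alpha).
  rewrite powRM ?invr_ge0 ?(ltW T0) // mulrC; congr (_ * _).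
  by rewrite -powR_inv1 // -powRrM; congr (_ `^ _); ring.
rewrite -opprB !powRN lef_pV2 ?posrE ?powR_gt0 ?ltr0n ?divr_gt0 //.
by rewrite ge0_ler_powR ?nnegrE ?(ltW am1) // divr_ge0 // ltW.
Qed.

End power_sums.

(** * Strong measurability *)

Section strong_measurability.
Context {d : measure_display} {T : measurableType d} {R : realType}.

(** Finite range and measurable fibres: unlike a linear combination of
    indicators, this makes sense in any type and is visibly stable under
    composition with arbitrary maps. *)
Definition simple_map (V : Type) (s : T -> V) : Prop :=
  finite_set (range s) /\ forall v, measurable (s @^-1` [set v]).

Lemma simple_map_preimage (V : Type) (s : T -> V) B :
  simple_map s -> measurable (s @^-1` B).
Proof.
move=> [fin fib].
have -> : s @^-1` B = \bigcup_(v in range s `&` B) (s @^-1` [set v]).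
  apply/seteqP; split=> [x Bx|x [v [_ Bv] /= e]]; last by rewrite /= e.
  by exists (s x) => //; split => //; exists x.
by apply: fin_bigcup_measurable => //; exact: finite_setIl.
Qed.

Lemma simple_map_cst (V : Type) (v : V) : simple_map (fun=> v).
Proof.
split; first by apply: sub_finite_set (finite_set1 v) => _ [x _ <-].
move=> u; have [->|uv] := pselect (u = v).
  rewrite [X in measurable X](_ : _ = setT) //.
  by apply/seteqP; split.
rewrite [X in measurable X](_ : _ = set0) //.
by apply/seteqP; split => // x /= vu; case: uv.
Qed.

Lemma simple_map_comp (V W : Type) (f : V -> W) (s : T -> V) :
  simple_map s -> simple_map (fun x => f (s x)).
Proof.
move=> ss; split.
  have -> : range (fun x => f (s x)) = f @` range s.
    by rewrite -image_comp.
  by apply: finite_image; case: ss.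
by move=> w; exact: (simple_map_preimage (f @^-1` [set w]) ss).
Qed.

Lemma simple_map_pair (V W : Type) (s : T -> V) (t : T -> W) :
  simple_map s -> simple_map t -> simple_map (fun x => (s x, t x)).
Proof.
move=> [fs ms] [ft mt]; split.
  apply: sub_finite_set (finite_setX fs ft) => _ [x _ <-] /=.
  by split; exists x.
move=> [v w].
rewrite [X in measurable X](_ : _ = s @^-1` [set v] `&` t @^-1` [set w]).
  exact: measurableI.
by apply/seteqP; split=> x /= [sxv txw]; [split|congr pair].
Qed.

Lemma simple_map_comp2 (V W U : Type) (f : V -> W -> U) s t :
  simple_map s -> simple_map t -> simple_map (fun x => f (s x) (t x)).
Proof.
by move=> ss st; exact: (simple_map_comp (fun z => f z.1 z.2) (simple_map_pair ss st)).
Qed.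

Lemma simple_map_indic (A : set T) : measurable A -> simple_map (\1_A : T -> R).
Proof.
move=> mA; split.
  apply: (@sub_finite_set _ _ [set 0; 1]); last first.
    by rewrite finite_setU; split; exact: finite_set1.
  by move=> _ [x _ <-]; rewrite indicE; case: (_ \in _); [right|left].
move=> v; have -> : (\1_A : T -> R) @^-1` [set v] =
    (if v == 1 then A else set0) `|` (if v == 0 then ~` A else set0).
  apply/seteqP; split=> [x /=|x].
    rewrite indicE; have [xA|xA] := boolP (x \in A) => <-.
      by left; rewrite eqxx; rewrite inE in xA.
    by right; rewrite eqxx; rewrite notin_setE in xA.
  case; case: eqP => //= -> Ax; rewrite indicE; first by rewrite mem_set.
  by rewrite memNset.
by apply: measurableU; case: ifP => // _; exact: measurableC.
Qed.

Lemma simple_map_measurable (s : T -> R) : simple_map s -> measurable_fun setT s.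
Proof. by move=> ss _ B mB; rewrite setTI; exact: simple_map_preimage. Qed.

Lemma simple_mapE (V : lmodType R) (s : T -> V) : simple_map s ->
  exists (m : nat) (A : nat -> set T) (v : nat -> V),
    (forall k, measurable (A k)) /\
    forall x, s x = \sum_(k < m) (\1_(A k) x : R) *: v k.
Proof.
move=> ss; have [fs ms] := ss.
pose l : seq V := finmap.enum_fset (fset_set (range s)).
have lE x : s x \in l by rewrite in_fset_set // inE; exists x.
have ul : uniq l by exact: finmap.fset_uniq.
exists (size l), (fun k => s @^-1` [set nth 0 l k]), (nth 0 l); split=> // x.
have il : (index (s x) l < size l)%N by rewrite index_mem.
rewrite (bigD1 (Ordinal il)) //= indicE mem_set /= ?nth_index // scale1r.
rewrite big1 ?addr0 // => i ix; rewrite indicE memNset ?scale0r //= => e.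
by case/eqP: ix; apply/val_inj => /=; rewrite e index_uniq.
Qed.

Lemma simple_map_bounded (V : normedModType R) (s : T -> V) : simple_map s ->
  exists C : R, forall x, `|s x| <= C.
Proof.
move=> ss; have [m [A [v [_ sE]]]] := simple_mapE ss.
exists (\sum_(k < m) `|v k|) => x; rewrite sE (le_trans (ler_norm_sum _ _ _)) //.
apply: ler_sum => k _; rewrite normrZ ler_piMl // indicE.
by case: (_ \in _); rewrite ?normr1 ?normr0.
Qed.

(** Bounded strongly measurable maps. The approximating sequence is uniformly
    bounded so that dominated convergence applies to every integral built from
    it. *)
Definition bsm (V : normedModType R) (F : T -> V) : Prop :=
  exists (C : R) (s : nat -> T -> V), [/\ forall n, simple_map (s n),
    forall n x, `|s n x| <= C & forall x, s n x @[n --> \oo] --> F x].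

Lemma bsm_simple (V : normedModType R) (s : T -> V) : simple_map s -> bsm s.
Proof.
move=> ss; have [C sC] := simple_map_bounded ss.
by exists C, (fun=> s); split => // x; exact: cvg_cst.
Qed.

Lemma bsm_cst (V : normedModType R) (v : V) : bsm (fun=> v).
Proof. by apply: bsm_simple; exact: simple_map_cst. Qed.

Lemma bsm_bounded (V : normedModType R) (F : T -> V) : bsm F ->
  exists2 C : R, 0 <= C & forall x, `|F x| <= C.
Proof.
move=> [C [s [_ sC sF]]].
have FC x : `|F x| <= C by apply: (cvgn_le (cvg_norm (sF x))) => n; exact: sC.
by exists C => //; exact: le_trans (normr_ge0 _) (FC point).
Qed.

(** The approximations are composed with [b], which must preserve limits of
    sequences and map bounded sets to bounded sets; linear combinations, inner
    products and projections all qualify. *)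
Lemma bsm_comp2 (V W U : normedModType R) (b : V -> W -> U) (F : T -> V)
    (G : T -> W) :
  (forall (vn : nat -> V) (wn : nat -> W) v w, vn @ \oo --> v ->
     wn @ \oo --> w -> b (vn n) (wn n) @[n --> \oo] --> b v w) ->
  (forall C D : R, exists E : R,
     forall v w, `|v| <= C -> `|w| <= D -> `|b v w| <= E) ->
  bsm F -> bsm G -> bsm (fun x => b (F x) (G x)).
Proof.
move=> bcont bbnd [C [s [ss sC sF]]] [D [t [st tD tG]]].
have [E hE] := bbnd C D.
exists E, (fun n x => b (s n x) (t n x)); split => [n|n x|x].
- exact: simple_map_comp2.
- exact: hE.
- exact: bcont.
Qed.

Lemma bsm_comp (V U : normedModType R) (b : V -> U) (F : T -> V) :
  (forall (vn : nat -> V) v, vn @ \oo --> v -> b (vn n) @[n --> \oo] --> b v) ->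
  (forall C : R, exists E : R, forall v, `|v| <= C -> `|b v| <= E) ->
  bsm F -> bsm (fun x => b (F x)).
Proof.
move=> bc bb hF; apply: (bsm_comp2 (b := fun v _ => b v) (G := F)) => //.
- by move=> vn wn v w vv _; exact: bc.
- by move=> C D; have [E hE] := bb C; exists E => v w /hE.
Qed.

Lemma bsmB (V : normedModType R) (F G : T -> V) :
  bsm F -> bsm G -> bsm (fun x => F x - G x).
Proof.
apply: (@bsm_comp2 V V V (fun v w => v - w)); first by move=> *; exact: cvgB.
move=> C D; exists (C + D) => v w vC wD.
by rewrite (le_trans (ler_normB _ _)) // lerD.
Qed.

Lemma bsmD (V : normedModType R) (F G : T -> V) :
  bsm F -> bsm G -> bsm (fun x => F x + G x).
Proof.
apply: (@bsm_comp2 V V V (fun v w => v + w)); first by move=> *; exact: cvgD.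
move=> C D; exists (C + D) => v w vC wD.
by rewrite (le_trans (ler_normD _ _)) // lerD.
Qed.

Lemma bsmZ (V : normedModType R) (a : T -> R) (F : T -> V) :
  bsm a -> bsm F -> bsm (fun x => a x *: F x).
Proof.
apply: (@bsm_comp2 R V V (fun (a : R) (v : V) => a *: v)); first by move=> *; exact: cvgZ.
move=> C D; exists (C * D) => v w vC wD.
by rewrite normrZ ler_pM.
Qed.

Lemma bsm_norm (V : normedModType R) (F : T -> V) : bsm F -> bsm (fun x => `|F x| : R).
Proof.
apply: (@bsm_comp V R (fun v : V => `|v| : R)); first by move=> *; exact: cvg_norm.
by move=> C; exists C => v; rewrite normr_id.
Qed.

Lemma bsm_dot (H : hilbertType R) (F G : T -> H) :
  bsm F -> bsm G -> bsm (fun x => dot (F x) (G x) : R).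
Proof.
apply: (@bsm_comp2 H H R (fun v w : H => dot v w : R)); first by move=> *; exact: cvg_dot.
move=> C D; exists (C * D) => v w vC wD.
by rewrite (le_trans (cauchy_schwarz _ _)) // ler_pM.
Qed.

Lemma bsmM (a b : T -> R) : bsm a -> bsm b -> bsm (fun x => a x * b x).
Proof. by move=> ba bb; exact: (bsmZ (V := R)). Qed.

Lemma bsm_sum (V : normedModType R) I (r : seq I) (Q : pred I) (F : I -> T -> V) :
  (forall i, bsm (F i)) -> bsm (fun x => \sum_(i <- r | Q i) F i x).
Proof.
move=> bF; elim: r => [|i r IH].
  by under eq_fun do rewrite big_nil; exact: bsm_cst.
under eq_fun do rewrite big_cons; case: (Q i) => //; exact: bsmD.
Qed.

Lemma bsm_measurable (f : T -> R) : bsm f -> measurable_fun setT f.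
Proof.
move=> [C [s [ss _ sf]]]; apply: (measurable_fun_cvg (h := s)) => [n|x _].
  exact: simple_map_measurable.
exact: sf.
Qed.

End strong_measurability.

Lemma simple_map_precomp d d' (T : measurableType d) (U : measurableType d')
    (V : Type) (Z : T -> U) (s : U -> V) :
  measurable_fun setT Z -> simple_map s -> simple_map (fun x => s (Z x)).
Proof.
move=> mZ [fs ms]; split.
  by apply: sub_finite_set fs => _ [x _ <-]; exists (Z x).
by move=> v; have := mZ measurableT _ (ms v); rewrite setTI.
Qed.

Lemma bsm_precomp d d' (T : measurableType d) (U : measurableType d')
    (R : realType) (V : normedModType R) (Z : T -> U) (F : U -> V) :
  measurable_fun setT Z -> bsm F -> bsm (fun x => F (Z x)).
Proof.
move=> mZ [C [s [ss sC sF]]]; exists C, (fun n x => s n (Z x)); split => //.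
by move=> n; exact: simple_map_precomp.
Qed.

(** * Expectations and means of Hilbert-valued maps *)

Section expectation.
Context {d : measure_display} {T : measurableType d} {R : realType}.
Variable P : probability T R.
Implicit Types (f g : T -> R).

Lemma bsm_integrable f : bsm f -> P.-integrable setT (EFin \o f).
Proof.
move=> bf; apply: measurable_bounded_integrable => //.
- by rewrite fin_num_fun_lty //; exact: fin_num_measure.
- exact: bsm_measurable.
- have [C C0 fC] := bsm_bounded bf; exists C; split; first exact: num_real.
  move=> D CD x _; exact: (le_trans (fC x) (ltW CD)).
Qed.

Lemma expectD f g : bsm f -> bsm g ->
  \int[P]_x (f x + g x) = \int[P]_x f x + \int[P]_x g x.
Proof. by move=> bf bg; rewrite RintegralD //; exact: bsm_integrable. Qed.

Lemma expectB f g : bsm f -> bsm g ->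
  \int[P]_x (f x - g x) = \int[P]_x f x - \int[P]_x g x.
Proof. by move=> bf bg; rewrite RintegralB //; exact: bsm_integrable. Qed.

Lemma expectZ (a : R) f : bsm f -> \int[P]_x (a * f x) = a * \int[P]_x f x.
Proof. by move=> bf; rewrite RintegralZl //; exact: bsm_integrable. Qed.

Lemma expect_cst (a : R) : \int[P]_x a = a.
Proof.
rewrite Rintegral_cst // -[RHS]mulr1; congr (_ * _).
exact: (congr1 fine (probability_setT P)).
Qed.

Lemma expect_le f g : bsm f -> bsm g -> (forall x, f x <= g x) ->
  \int[P]_x f x <= \int[P]_x g x.
Proof.
by move=> bf bg fg; apply: le_Rintegral => //; exact: bsm_integrable.
Qed.

Lemma expect_abs f : bsm f -> `|\int[P]_x f x| <= \int[P]_x `|f x|.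
Proof. by move=> bf; apply: le_normr_Rintegral => //; exact: bsm_integrable. Qed.

Lemma expect_sum I (r : seq I) (Q : pred I) (F : I -> T -> R) :
  (forall i, bsm (F i)) ->
  \int[P]_x (\sum_(i <- r | Q i) F i x) = \sum_(i <- r | Q i) \int[P]_x F i x.
Proof.
move=> bF; elim: r => [|i r IH].
  rewrite big_nil; under eq_Rintegral do rewrite big_nil.
  exact: expect_cst.
rewrite big_cons; under eq_Rintegral do rewrite big_cons.
case: (Q i) => //; rewrite expectD ?IH //.
exact: bsm_sum.
Qed.

Lemma expect_indic A : measurable A -> \int[P]_x (\1_A x : R) = fine (P A).
Proof. by move=> mA; rewrite /Rintegral integral_indic // setIT. Qed.

Lemma expect_cvg (fn : nat -> T -> R) f (C : R) :
  (forall n, bsm (fn n)) -> (forall n x, `|fn n x| <= C) ->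
  (forall x, fn n x @[n --> \oo] --> f x) ->
  \int[P]_x fn n x @[n --> \oo] --> \int[P]_x f x.
Proof.
move=> bfn fnC fnf; have mf : measurable_fun setT f.
  by apply: (measurable_fun_cvg (h := fn)) => [n|x _] //; exact: bsm_measurable.
have C0 : 0 <= C by exact: le_trans (normr_ge0 _) (fnC 0%N point).
have [|||||intf _ h] := @dominated_convergence _ T R P setT measurableT
  (fun n x => (fn n x)%:E) (EFin \o f) (fun=> C%:E).
- by move=> n; apply/measurable_EFinP; exact: bsm_measurable.
- exact/measurable_EFinP.
- by apply: aeW => x _; apply: cvg_EFin; [exact: nearW|exact: fnf].
- exact: (bsm_integrable (bsm_cst C)).
- by apply: aeW => x n _; rewrite lee_fin.
apply: fine_cvg; rewrite fineK; first exact: h.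
exact: integrable_fin_num intf.
Qed.


(** The mean in the weak (Pettis) sense, which is the form in which means and
    covariances are used. *)
Definition is_mean (H : hilbertType R) (F : T -> H) (m : H) : Prop :=
  forall w, dot w m = \int[P]_x dot w (F x).

Lemma expect_sum_indic (V : Type) (n : nat) (A : nat -> set T) (v : nat -> V)
    (l : V -> R) : (forall k, measurable (A k)) ->
  \int[P]_x (\sum_(k < n) \1_(A k) x * l (v k)) =
  \sum_(k < n) fine (P (A k)) * l (v k).
Proof.
move=> mA; have bA k : bsm (\1_(A k) : T -> R).
  by apply: bsm_simple; exact: simple_map_indic.
rewrite expect_sum; last by move=> k; apply: bsmM => //; exact: bsm_cst.
apply: eq_bigr => k _; under eq_Rintegral do rewrite mulrC.
by rewrite expectZ // expect_indic // mulrC.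
Qed.

Lemma is_mean_sum_indic (H : hilbertType R) (s : T -> H) (n : nat)
    (A : nat -> set T) (v : nat -> H) :
  (forall k, measurable (A k)) ->
  (forall x, s x = \sum_(k < n) (\1_(A k) x : R) *: v k) ->
  is_mean s (\sum_(k < n) fine (P (A k)) *: v k).
Proof.
move=> mA sE w; rewrite dot_sumr; under eq_bigr do rewrite dotZr.
rewrite -(expect_sum_indic n v (fun z : H => dot w z) mA); apply: eq_Rintegral => x _.
by rewrite sE dot_sumr; apply: eq_bigr => k _; rewrite dotZr.
Qed.

Lemma is_mean_simple (H : hilbertType R) (s : T -> H) :
  simple_map s -> exists m, is_mean s m.
Proof.
move=> /simple_mapE[n [A [v [mA sE]]]].
by exists (\sum_(k < n) fine (P (A k)) *: v k); exact: is_mean_sum_indic.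
Qed.

Lemma is_mean_dist (H : hilbertType R) (F G : T -> H) m m' :
  bsm F -> bsm G -> is_mean F m -> is_mean G m' ->
  `|m - m'| <= \int[P]_x `|F x - G x|.
Proof.
move=> bF bG Fm Gm; have bFG := bsm_norm (bsmB bF bG).
apply: norm_le_dot => [|w].
  by apply: Rintegral_ge0.
have bdot (F' : T -> H) : bsm F' -> bsm (fun x => dot w (F' x) : R).
  by move=> bF'; apply: bsm_dot => //; exact: bsm_cst.
rewrite dotBr Fm Gm -expectB; [|exact: bdot|exact: bdot].
rewrite mulrC -expectZ //.
apply: expect_le; first by apply: bsmB; exact: bdot.
  by apply: bsmM => //; exact: bsm_cst.
by move=> x; rewrite -dotBr dot_le.
Qed.

Lemma bsm_approx (H : hilbertType R) (F : T -> H) (s : nat -> T -> H) (C : R) :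
  (forall n, simple_map (s n)) -> (forall n x, `|s n x| <= C) ->
  (forall x, s n x @[n --> \oo] --> F x) ->
  \int[P]_x `|s n x - F x| @[n --> \oo] --> (0 : R).
Proof.
move=> ss sC sF; have bF : bsm F by exists C, s.
have [D D0 FD] := bsm_bounded bF.
rewrite -(expect_cst 0); apply: (@expect_cvg _ _ (C + D)).
- by move=> n; apply/bsm_norm/bsmB => //; exact: bsm_simple.
- move=> n x; rewrite normr_id (le_trans (ler_normB _ _)) // lerD //.
- move=> x; rewrite -(@normr0 _ H) -(subrr (F x)); apply: cvg_norm.
  by apply: cvgB => //; exact: cvg_cst.
Qed.

(** The means of the approximating simple maps form a Cauchy sequence. *)
Lemma mean_exists (H : hilbertType R) (F : T -> H) :
  bsm F -> exists m, is_mean F m.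
Proof.
move=> bF; have [C [s [ss sC sF]]] := bF.
have bs n : bsm (s n) := bsm_simple (ss n).
have /choice[m sm] n : exists m, is_mean (s n) m by exact: is_mean_simple.
have a0 := bsm_approx ss sC sF.
pose a n := \int[P]_x `|s n x - F x|.
have mm j k : `|m j - m k| <= a j + a k.
  apply: le_trans (is_mean_dist (bs j) (bs k) (sm j) (sm k)) _.
  rewrite /a -expectD; [|exact/bsm_norm/bsmB|exact/bsm_norm/bsmB].
  apply: expect_le; first exact/bsm_norm/bsmB.
    by apply: bsmD; exact/bsm_norm/bsmB.
  by move=> x; rewrite [X in _ <= _ + X]distrC ler_distD.
have mc : cvgn m.
  apply/cauchy_cvgP; apply/cauchy_ballP => e e0; near_simpl.
  have e2 : 0 < e / 2 by rewrite divr_gt0.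
  have /cvgrPdist_lt /(_ _ e2) [N _ hN] := a0.
  exists ([set n | (N <= n)%N], [set n | (N <= n)%N]); first by split; exists N.
  move=> [j k] [/= Nj Nk]; rewrite -ball_normE /= (le_lt_trans (mm j k)) //.
  have lt_e i : (N <= i)%N -> a i < e / 2.
    by move=> /hN /=; rewrite sub0r normrN; apply: le_lt_trans; exact: ler_norm.
  by rewrite (splitr e) ltrD // lt_e.
exists (limn m) => w.
have h1 : dot w (m n) @[n --> \oo] --> dot w (limn m).
  exact: cvg_dot (cvg_cst w) mc.
have h2 : dot w (m n) @[n --> \oo] --> \int[P]_x dot w (F x).
  under eq_cvg do rewrite sm.
  apply: (@expect_cvg _ _ (`|w| * C)).
  - by move=> n; apply: bsm_dot => //; exact: bsm_cst.
  - by move=> n x; rewrite (le_trans (cauchy_schwarz _ _)) // ler_wpM2l.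
  - by move=> x; apply: cvg_dot => //; exact: cvg_cst.
exact: (cvg_unique (@Rhausdorff R) h1 h2).
Qed.

Lemma EFin_expect f : bsm f -> (\int[P]_x (f x)%:E)%E = (\int[P]_x f x)%:E.
Proof.
by move=> bf; rewrite /Rintegral fineK //; exact: integrable_fin_num (bsm_integrable bf).
Qed.

(** Reading off a Bochner integral through a linear functional which the norm
    [N] controls. The approximations of an operator-valued integral may be
    arbitrary maps, so only [N] and [l] enter. *)
Lemma bochner_functional (V : lmodType R) (N : V -> \bar R) (Z : T -> V) (u : V)
    (l : V -> R) (C : R) :
  (forall v, (0 <= N v)%E) -> 0 <= C ->
  (forall a x y, l (a *: x + y) = a * l x + l y) ->
  (forall v, (`|l v|%:E <= C%:E * N v)%E) ->
  bsm (l \o Z) -> is_bochner P N Z u -> l u = \int[P]_x l (Z x).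
Proof.
move=> N0 C0 llin lN blZ [n [A [v [mA mrest rest0 sum0]]]].
have l0 : l 0 = 0.
  by have := llin (-1) 0 0; rewrite scaler0 addr0 mulN1r addNr.
have lD x y : l (x + y) = l x + l y by have := llin 1 x y; rewrite scale1r mul1r.
have lZ a x : l (a *: x) = a * l x by have := llin a x 0; rewrite l0 !addr0.
have lB x y : l (x - y) = l x - l y by rewrite -scaleN1r lD lZ mulN1r.
have lS k (F : 'I_k -> V) : l (\sum_i F i) = \sum_i l (F i).
  exact: (big_morph l lD l0).
pose D k := \sum_(i < n k) fine (P (A k i)) *: v k i.
pose s k x := \sum_(i < n k) (\1_(A k i) x : R) *: v k i.
have bs k : bsm (fun x => l (s k x)).
  rewrite /s; under eq_fun do rewrite lS; apply: bsm_sum => i.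
  under eq_fun do rewrite lZ; apply: bsmM; last exact: bsm_cst.
  by apply: bsm_simple; exact: simple_map_indic.
have lDE k : l (D k) = \int[P]_x l (s k x).
  rewrite lS; under eq_bigr do rewrite lZ.
  rewrite -(expect_sum_indic (n k) (v k) l (mA k)); apply: eq_Rintegral => x _.
  by rewrite lS; apply: eq_bigr => i _; rewrite lZ.
have bound k : (`|l u - \int[P]_x l (Z x)|%R%:E <=
    C%:E * N (D k - u)%R + C%:E * \int[P]_x N (Z x - s k x)%R)%E.
  apply: (@le_trans _ _ (`|l (D k - u)|%R%:E + `|l (D k) - \int[P]_x l (Z x)|%R%:E)%E).
    by rewrite -EFinD lee_fin lB (distrC (l (D k))) ler_distD.
  apply: leeD; first exact: lN.
  rewrite lDE -expectB //; apply: (@le_trans _ _ (\int[P]_x `|l (s k x) - l (Z x)|)%R%:E).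
    by rewrite lee_fin expect_abs //; exact: bsmB.
  rewrite -EFin_expect; last by apply/bsm_norm/bsmB.
  rewrite -ge0_integralZl_EFin //; last exact: mrest.
  apply: ge0_le_integral => //.
  - suff : measurable_fun setT (fun x => `|l (s k x) - l (Z x)|) by move/measurable_EFinP.
    exact/bsm_measurable/bsm_norm/bsmB.
  - by apply: measurable_funeM; exact: mrest.
  - by move=> x _; rewrite distrC -lB; exact: lN.
have lim0 : (C%:E * N (D k - u)%R + C%:E * \int[P]_x N (Z x - s k x)%R)%E @[k --> \oo]
    --> 0%E.
  have -> : 0%E = (C%:E * 0 + C%:E * 0)%E by rewrite !mule0 adde0.
  by apply: cvgeD; [rewrite !mule0|exact: cvgeZl|exact: cvgeZl].
have : (`|l u - \int[P]_x l (Z x)|%R%:E <= 0)%E.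
  rewrite -[leRHS](cvg_lim (@ereal_hausdorff R) lim0).
  apply: lime_ge; first by apply/cvg_ex; exists 0%E.
  exact: nearW bound.
by rewrite lee_fin normr_le0 subr_eq0 => /eqP.
Qed.

End expectation.

(** * Operator norm and existence of Bochner integrals *)

Section operator_norm.
Context {R : realType} {E F : normedModType R}.
Implicit Types A B : E -> F.

Lemma opnorm_ge0 A : (0 <= opnorm A)%E.
Proof. by apply: le_ereal_inf_tmp => _ [M [M0 _] <-]; rewrite lee_fin. Qed.

Lemma opnorm_le A (M : R) : 0 <= M -> (forall x, `|A x| <= M * `|x|) ->
  (opnorm A <= M%:E)%E.
Proof. by move=> M0 AM; apply: ereal_inf_lbound; exists M. Qed.

Lemma opnorm_lty A (M : R) : 0 <= M -> (forall x, `|A x| <= M * `|x|) ->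
  (opnorm A < +oo)%E.
Proof. by move=> M0 AM; apply: le_lt_trans (opnorm_le M0 AM) _; rewrite ltry. Qed.

Lemma opnorm_fineK A : (opnorm A < +oo)%E -> (fine (opnorm A))%:E = opnorm A.
Proof.
by move=> Aoo; rewrite fineK // ge0_fin_numE // opnorm_ge0.
Qed.

Lemma fine_opnorm_ge0 A : 0 <= fine (opnorm A).
Proof. by rewrite fine_ge0 // opnorm_ge0. Qed.

Lemma fine_opnorm_le A (M : R) : 0 <= M -> (forall x, `|A x| <= M * `|x|) ->
  fine (opnorm A) <= M.
Proof.
by move=> M0 AM; rewrite -lee_fin opnorm_fineK ?opnorm_le // (opnorm_lty M0).
Qed.

(** The infimum that defines the operator norm is attained, as each bound
    [M] is at least [`|A x| / `|x|]. *)
Lemma opnormP A x : (opnorm A < +oo)%E -> `|A x| <= fine (opnorm A) * `|x|.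
Proof.
move=> Aoo; have [x0|x0] := eqVneq `|x| 0.
  have [_ [M [M0 AM] _] _] := ereal_inf_lt Aoo.
  by have := AM x; rewrite x0 !mulr0.
have {}x0 : 0 < `|x| by rewrite lt_neqAle eq_sym x0 normr_ge0.
rewrite -ler_pdivrMr // -lee_fin opnorm_fineK //.
apply: le_ereal_inf_tmp => _ [M [M0 AM] <-].
by rewrite lee_fin ler_pdivrMr.
Qed.

(** The term [1] makes the bound meaningful at [x = 0] for a map which is not
    linear and has infinite norm, where [+oo * 0 = 0]. *)
Lemma opnorm_apply A x : (`|A x|%:E <= opnorm A * (1 + `|x|)%:E)%E.
Proof.
have [Aoo|] := ltP (opnorm A) +oo%E.
  rewrite -opnorm_fineK // -EFinM lee_fin (le_trans (opnormP x Aoo)) //.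
  by rewrite ler_wpM2l ?fine_opnorm_ge0 // lerDr.
by rewrite leye_eq => /eqP ->; rewrite gt0_mulye ?leey // lte_fin ltr_wpDr.
Qed.

Lemma fine_opnorm_dist A B (M : R) : 0 <= M ->
  (opnorm A < +oo)%E -> (opnorm B < +oo)%E ->
  (forall x, `|A x - B x| <= M * `|x|) ->
  `|fine (opnorm A) - fine (opnorm B)| <= M.
Proof.
move=> M0 Aoo Boo AB; rewrite ler_distl lerBlDr; apply/andP; split.
  apply: fine_opnorm_le => [|x]; first by rewrite addr_ge0 // fine_opnorm_ge0.
  rewrite mulrDl -[B x](subKr (A x)) (le_trans (ler_normB _ _)) //.
  by rewrite lerD // opnormP.
apply: fine_opnorm_le => [|x]; first by rewrite addr_ge0 // fine_opnorm_ge0.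
rewrite mulrDl -[A x](subrK (B x)) (le_trans (ler_normD _ _)) // addrC.
by rewrite lerD // opnormP.
Qed.

End operator_norm.

Section bochner_existence.
Context {d : measure_display} {T : measurableType d} {R : realType}.
Variable P : probability T R.

(** The simple functions of the definition are given by weights and indicators;
    [simple_mapE] provides them for maps of finite range, but without naming
    them, so the last hypothesis ranges over all such representations. *)
Lemma bochner_intro (V : lmodType R) (N : V -> \bar R) (Z : T -> V) (u : V)
    (S : nat -> T -> V) :
  (forall v, (0 <= N v)%E) -> (forall n, simple_map (S n)) ->
  (forall n, measurable_fun setT (fun x => N (Z x - S n x))) ->
  (\int[P]_x N (Z x - S n x)%R)%E @[n --> \oo] --> 0%E ->
  (forall n m (A : nat -> set T) (v : nat -> V), (forall k, measurable (A k)) ->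
     (forall x, S n x = \sum_(k < m) (\1_(A k) x : R) *: v k) ->
     (N (\sum_(k < m) fine (P (A k)) *: v k - u)%R <=
      \int[P]_x N (Z x - S n x)%R)%E) ->
  is_bochner P N Z u.
Proof.
move=> N0 sS mS S0 hu.
have /choice[D hD] n : exists D : nat * (nat -> set T) * (nat -> V),
    (forall k, measurable (D.1.2 k)) /\
    forall x, S n x = \sum_(k < D.1.1) (\1_(D.1.2 k) x : R) *: D.2 k.
  by have [m [A [v h]]] := simple_mapE (sS n); exists (m, A, v).
exists (fun n => (D n).1.1), (fun n => (D n).1.2), (fun n => (D n).2) => rest.
have restE n : rest n = fun x => N (Z x - S n x).
  by apply/funext => x; rewrite /rest (hD n).2.
split.
- by move=> n k; exact: (hD n).1.
- by move=> n; rewrite restE.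
- by under eq_cvg do rewrite restE.
- apply: (@squeeze_cvge _ _ _ _ (fun=> 0%E) _ (fun n => \int[P]_x N (Z x - S n x)%R)%E) => //.
    apply: nearW => n; rewrite N0 /=.
    by apply: hu; [exact: (hD n).1|exact: (hD n).2].
  exact: cvg_cst.
Qed.

Lemma bochner_norm (H : hilbertType R) (F : T -> H) (m : H) :
  bsm F -> is_mean P F m -> is_bochner P (fun u : H => (`|u|)%:E) F m.
Proof.
move=> bF Fm; have [C [s [ss sC sF]]] := bF.
have bs n : bsm (s n) := bsm_simple (ss n).
have bn n : bsm (fun x => `|F x - s n x| : R) by apply/bsm_norm/bsmB.
apply: (@bochner_intro _ _ _ _ s) => //.
- move=> n; suff : measurable_fun setT (fun x => `|F x - s n x|) by move/measurable_EFinP.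
  exact: bsm_measurable.
- under eq_cvg do rewrite EFin_expect //.
  apply: cvg_EFin; first exact: nearW.
  have := bsm_approx P ss sC sF; under eq_cvg do under eq_Rintegral do rewrite distrC.
  exact.
- move=> n k A v mA sE; rewrite EFin_expect // lee_fin distrC.
  exact: is_mean_dist (is_mean_sum_indic P mA sE).
Qed.

End bochner_existence.

(** * Bochner integrals of rank-one operators *)

Section rank_one.
Context {R : realType} {H1 H2 : hilbertType R}.
Implicit Types (u : H1) (v w : H2).

Lemma tensor_le u v w : `|tensor u v w| <= `|u| * `|v| * `|w|.
Proof.
by rewrite normrZ mulrC -mulrA ler_wpM2l // cauchy_schwarz.
Qed.

Lemma tensor_dist u v u' v' w :
  `|tensor u v w - tensor u' v' w| <=
  (`|u - u'| * `|v| + `|u'| * `|v - v'|) * `|w|.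
Proof.
have -> : tensor u v w - tensor u' v' w = tensor (u - u') v w + tensor u' (v - v') w.
  by rewrite /tensor scalerBr dotBl scalerBl addrA subrK.
by rewrite (le_trans (ler_normD _ _)) // mulrDl lerD // tensor_le.
Qed.

(** A function of a pair of pairs of vectors, so that it can be composed with
    pairs of simple maps; it is real-valued since rank-one operators are
    bounded. *)
Definition tensor_gap (z : H1 * H2 * (H1 * H2)) : R :=
  fine (opnorm (tensor z.1.1 z.1.2 - tensor z.2.1 z.2.2)).

Lemma tensor_gap_lty u v u' v' : (opnorm (tensor u v - tensor u' v')%R < +oo)%E.
Proof.
apply: (@opnorm_lty _ _ _ _ (`|u - u'| * `|v| + `|u'| * `|v - v'|)).
  by rewrite addr_ge0 ?mulr_ge0.
by move=> w; exact: tensor_dist.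
Qed.

Lemma tensor_gap_le u v u' v' :
  tensor_gap ((u, v), (u', v')) <= `|u - u'| * `|v| + `|u'| * `|v - v'|.
Proof.
apply: fine_opnorm_le => [|w]; first by rewrite addr_ge0 ?mulr_ge0.
exact: tensor_dist.
Qed.

Lemma tensor_gap_dist u v u1 v1 u' v' :
  `|tensor_gap ((u, v), (u', v')) - tensor_gap ((u1, v1), (u', v'))| <=
  `|u - u1| * `|v| + `|u1| * `|v - v1|.
Proof.
apply: fine_opnorm_dist; [|exact: tensor_gap_lty|exact: tensor_gap_lty|].
  by rewrite addr_ge0 ?mulr_ge0.
move=> w; rewrite /= !fctE opprB addrA subrK.
exact: tensor_dist.
Qed.

End rank_one.

Section operator_bochner.
Context {d : measure_display} {T : measurableType d} {R : realType}.
Variable P : probability T R.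
Context {H1 H2 : hilbertType R}.
Variables (F : T -> H1) (G : T -> H2).
Hypotheses (bF : bsm F) (bG : bsm G).

(** The integral [K] is defined pointwise by the weak means of
    [tensor (F x) (G x) g]. The approximations [tensor (s n x) (t n x)] converge
    to [tensor (F x) (G x)] in operator norm, and that norm is a continuous
    function of the vectors, which makes it measurable along [F] and [G]. *)
Lemma cross_bochner_exists :
  exists C : H2 -> H1, is_bochner P (fun A : H2 -> H1 => opnorm A)
    (fun x => tensor (F x) (G x)) C.
Proof.
have [C [s [ss sC sF]]] := bF; have [D [t [st tD tG]]] := bG.
have [CF CF0 FC] := bsm_bounded bF; have [DG DG0 GD] := bsm_bounded bG.
have C0 : 0 <= C by exact: le_trans (normr_ge0 _) (sC 0%N point).
have D0 : 0 <= D by exact: le_trans (normr_ge0 _) (tD 0%N point).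
have bFG g : bsm (fun x => tensor (F x) (G x) g).
  by apply: bsmZ => //; apply: bsm_dot => //; exact: bsm_cst.
have bst n g : bsm (fun x => tensor (s n x) (t n x) g).
  by apply: bsm_simple; exact: (simple_map_comp2 (fun u v => tensor u v g)).
have /choice[K KE] g : exists m, is_mean P (fun x => tensor (F x) (G x) g) m.
  exact: mean_exists.
pose r n x := tensor_gap ((F x, G x), (s n x, t n x)).
have gap_bound u v u' v' : `|u| <= CF + C -> `|v| <= DG + D -> `|u'| <= C ->
    `|v'| <= D -> `|tensor_gap ((u, v), (u', v'))| <=
       (CF + C + C) * (DG + D) + C * (DG + D + D).
  move=> hu hv hu' hv'; rewrite ger0_norm ?fine_opnorm_ge0 //.
  rewrite (le_trans (tensor_gap_le _ _ _ _)) // lerD // ler_pM //.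
    by rewrite (le_trans (ler_normB _ _)) // lerD.
  by rewrite (le_trans (ler_normB _ _)) // lerD.
have cvg0 (u1 : nat -> H1) (v1 : nat -> H2) u v : u1 @ \oo --> u -> v1 @ \oo --> v ->
    `|u - u1 n| * `|v| + `|u1 n| * `|v - v1 n| @[n --> \oo] --> (0 : R).
  move=> u1u v1v.
  have -> : (0 : R) = `|u - u| * `|v| + `|u| * `|v - v|.
    by rewrite !subrr !normr0 mulr0 mul0r addr0.
  apply: cvgD; apply: cvgM; try exact: cvg_cst; try exact: cvg_norm.
    by apply: cvg_norm; apply: cvgB => //; exact: cvg_cst.
  by apply: cvg_norm; apply: cvgB => //; exact: cvg_cst.
have br n : bsm (r n).
  exists ((CF + C + C) * (DG + D) + C * (DG + D + D)),
    (fun m x => tensor_gap ((s m x, t m x), (s n x, t n x))); split.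
  - move=> m; apply: simple_map_comp; apply: simple_map_pair; exact: simple_map_pair.
  - by move=> m x; apply: gap_bound => //; rewrite ler_wpDl.
  - move=> x; apply/cvgrPdist_lt => e e0.
    have /cvgrPdist_lt /(_ e e0) := cvg0 _ _ _ _ (sF x) (tG x).
    apply: filterS => m; rewrite sub0r normrN ger0_norm; last first.
      by rewrite addr_ge0 ?mulr_ge0.
    by apply: le_lt_trans; exact: tensor_gap_dist.
have r0 : \int[P]_x r n x @[n --> \oo] --> (0 : R).
  rewrite -(expect_cst P 0).
  apply: (@expect_cvg _ _ _ _ _ _ ((CF + C + C) * (DG + D) + C * (DG + D + D))) => //.
    by move=> n x; apply: gap_bound => //; rewrite ler_wpDr.
  move=> x; apply/cvgrPdist_lt => e e0.
  have /cvgrPdist_lt /(_ e e0) : `|F x - s n x| * `|G x| + `|s n x| * `|G x - t n x|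
      @[n --> \oo] --> (0 : R) by exact: cvg0.
  apply: filterS => m; rewrite sub0r normrN ger0_norm; last first.
    by rewrite addr_ge0 ?mulr_ge0.
  rewrite sub0r normrN (ger0_norm (fine_opnorm_ge0 _)).
  by apply: le_lt_trans; exact: tensor_gap_le.
have opE n x : (opnorm (tensor (F x) (G x) - tensor (s n x) (t n x))) = (r n x)%:E.
  by rewrite opnorm_fineK // tensor_gap_lty.
have intE n : (\int[P]_x opnorm (tensor (F x) (G x) - tensor (s n x) (t n x))%R)%E =
    (\int[P]_x r n x)%:E.
  by under eq_integral do rewrite opE; rewrite EFin_expect.
exists K; apply: (@bochner_intro _ _ _ _ _ _ _ _ (fun n x => tensor (s n x) (t n x))).
- by move=> v; exact: opnorm_ge0.
- by move=> n; exact: (simple_map_comp2 (fun u v => tensor u v)).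
- move=> n; under eq_fun do rewrite opE.
  suff : measurable_fun setT (r n) by move/measurable_EFinP.
  exact: bsm_measurable.
- by under eq_cvg do rewrite intE; apply: cvg_EFin => //; exact: nearW.
- move=> n m A v mA sE; rewrite intE.
  have E0 : 0 <= \int[P]_x r n x.
    by apply: Rintegral_ge0 => x _; exact: fine_opnorm_ge0.
  apply: opnorm_le => // g; apply: norm_le_dot => [|f]; first exact: mulr_ge0.
  have KE' : is_mean P (fun x => tensor (s n x) (t n x) g)
      (\sum_(k < m) fine (P (A k)) *: v k g).
    apply: (@is_mean_sum_indic _ _ _ P _ _ m A (fun k => v k g)) => // x.
    by rewrite sE fct_sumE.
  have bfg (Q : T -> H1) : bsm Q -> bsm (fun x => dot f (Q x) : R).
    by move=> bQ; apply: bsm_dot => //; exact: bsm_cst.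
  rewrite /= !fctE fct_sumE dotBr KE' KE -expectB ?bfg //; [|exact: bfg|exact: bfg].
  rewrite -mulrA mulrC -expectZ //; apply: expect_le.
  + by apply: bsmB; exact: bfg.
  + by apply: bsmM => //; exact: bsm_cst.
  move=> x; rewrite -dotBr (le_trans (dot_le _ _)) // mulrC mulrAC.
  rewrite ler_wpM2r // mulrC -normrN opprB.
  by apply: (opnormP (A := tensor (F x) (G x) - tensor (s n x) (t n x))); exact: tensor_gap_lty.
Qed.

Lemma dot_cross_bochner f g :
  dot f (bochner P (fun A : H2 -> H1 => opnorm A) (fun x => tensor (F x) (G x)) g) =
  \int[P]_x (dot f (F x) * dot (G x) g).
Proof.
have hB : is_bochner P (fun A : H2 -> H1 => opnorm A) (fun x => tensor (F x) (G x))
    (bochner P (fun A : H2 -> H1 => opnorm A) (fun x => tensor (F x) (G x))).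
  by apply: xgetPex; exact: cross_bochner_exists.
rewrite (bochner_functional (l := fun A : H2 -> H1 => dot f (A g))
  (C := `|f| * (1 + `|g|)) _ _ _ _ _ hB).
- by apply: eq_Rintegral => x _; rewrite /tensor dotZr mulrC.
- by move=> A; exact: opnorm_ge0.
- by rewrite mulr_ge0 // addr_ge0.
- by move=> a A B; rewrite /= !fctE dotDr dotZr.
- move=> A; apply: (@le_trans _ _ (`|f|%:E * `|A g|%:E)%E).
    by rewrite -EFinM lee_fin cauchy_schwarz.
  rewrite EFinM -muleA lee_wpmul2l ?lee_fin // muleC; exact: opnorm_apply.
- apply: bsm_dot; first exact: bsm_cst.
  by apply: bsmZ => //; apply: bsm_dot => //; exact: bsm_cst.
Qed.

End operator_bochner.

Lemma bochner_is_mean d (T : measurableType d) (R : realType)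
    (P : probability T R) (H : hilbertType R) (F : T -> H) :
  bsm F -> is_mean P F (bochner P (fun u : H => (`|u|)%:E) F).
Proof.
move=> bF; have [m Fm] := mean_exists P bF.
have hB : is_bochner P (fun u : H => (`|u|)%:E) F
    (bochner P (fun u : H => (`|u|)%:E) F).
  by apply: xgetPex; exists m; exact: bochner_norm.
move=> w; apply: (bochner_functional (l := fun u => dot w u) (C := `|w|) _ _ _ _ _ hB).
- by move=> v; rewrite lee_fin.
- by [].
- by move=> a x y; rewrite dotDr dotZr.
- by move=> v; rewrite -EFinM lee_fin cauchy_schwarz.
- by apply: bsm_dot => //; exact: bsm_cst.
Qed.

(** * Independent samples *)

Section iid_sample.
Context {dO dU : measure_display} {Omega : measurableType dO}
  {U : measurableType dU} {R : realType}.
Variables (P : probability Omega R) (Z0 : Omega -> U) (Z : nat -> Omega -> U).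
Hypothesis mZ0 : measurable_fun setT Z0.
Hypothesis mZ : forall i, measurable_fun setT (Z i).
Hypothesis iid : iid_copies P Z0 Z.

Let mpre (X : Omega -> U) (A : set U) : measurable_fun setT X -> measurable A ->
  measurable (X @^-1` A).
Proof. by move=> mX mA; have := mX measurableT A mA; rewrite setTI. Qed.

Let bindic (X : Omega -> U) (A : set U) : measurable_fun setT X -> measurable A ->
  bsm (fun x => \1_A (X x) : R).
Proof.
move=> mX mA; apply: (bsm_precomp (F := \1_A : U -> R) mX).
by apply: bsm_simple; exact: simple_map_indic.
Qed.

Lemma expect_law f i : bsm f -> \int[P]_x f (Z i x) = \int[P]_x (f (Z0 x) : R).
Proof.
move=> [C [s [ss sC sf]]].
have cvgX X : measurable_fun setT X ->
    \int[P]_x s n (X x) @[n --> \oo] --> \int[P]_x (f (X x) : R).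
  move=> mX; apply: (@expect_cvg _ _ _ _ _ _ C) => // n.
  by apply: (bsm_precomp mX); exact: bsm_simple.
have h0 := cvgX _ mZ0; have hi := cvgX _ (mZ i).
have E n : \int[P]_x s n (Z i x) = \int[P]_x s n (Z0 x).
  have [m [A [v [mA sE]]]] := simple_mapE (ss n).
  have EX X : measurable_fun setT X -> \int[P]_x s n (X x) =
      \sum_(k < m) fine (P (X @^-1` A k)) * v k.
    move=> mX; have := expect_sum_indic P m v (@id R) (fun k => mpre mX (mA k)).
    rewrite /= => <-.
    by apply: eq_Rintegral => x _; rewrite sE.
  by rewrite !EX //; apply: eq_bigr => k _; rewrite iid.2.
by move: hi; under eq_cvg do rewrite E; move=> hi; exact: (cvg_unique (@Rhausdorff R) hi h0).
Qed.

Lemma expect_indep_indic i l A B : i != l -> measurable A -> measurable B ->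
  \int[P]_x (\1_A (Z i x) * \1_B (Z l x)) =
  fine (P (Z0 @^-1` A)) * fine (P (Z0 @^-1` B)) :> R.
Proof.
move=> il mA mB.
have mC j : measurable (if j == i then A else B) by case: ifP.
have := iid.1 [:: i; l] (fun j => if j == i then A else B).
rewrite /= inE il => /(_ erefl mC).
rewrite !big_cons big_nil mule1 eqxx eq_sym (negbTE il) !iid.2 // => PE.
rewrite -fineM; [|exact: fin_num_measure (mpre mZ0 mA)|exact: fin_num_measure (mpre mZ0 mB)].
rewrite -PE -expect_indic; last first.
  apply: fin_bigcap_measurable => // j _; exact: mpre.
apply: eq_Rintegral => x _; rewrite -[LHS](_ : \1_(Z i @^-1` A `&` Z l @^-1` B) x = _).
  congr (\1_ _ _); apply/seteqP; split => [y [Ay By] j /= | y h].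
    by rewrite !inE; case/orP => /eqP ->; rewrite ?eqxx // eq_sym (negbTE il).
  split; first by have := h i; rewrite /= eqxx; apply; rewrite inE eqxx.
  have := h l; rewrite /= eq_sym (negbTE il); apply.
  by rewrite !inE eqxx orbT.
by rewrite indicI.
Qed.

(** For maps of finite range both sides are finite sums over products of
    indicators; the general case follows by dominated convergence. *)
Lemma expect_dot_indep (H : hilbertType R) (F : U -> H) (m : H) i l : i != l ->
  bsm F -> is_mean P (fun x => F (Z0 x)) m ->
  \int[P]_x dot (F (Z i x)) (F (Z l x)) = dot m m.
Proof.
move=> il [C [s [ss sC sF]]] Fm.
have bF : bsm F by exists C, s.
have bs n : bsm (s n) := bsm_simple (ss n).
have h1 : \int[P]_x dot (s n (Z i x)) (s n (Z l x)) @[n --> \oo] -->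
    \int[P]_x dot (F (Z i x)) (F (Z l x)).
  apply: (@expect_cvg _ _ _ _ _ _ (C * C)).
  - by move=> n; apply: bsm_dot; exact: bsm_precomp.
  - by move=> n x; rewrite (le_trans (cauchy_schwarz _ _)) // ler_pM.
  - by move=> x; exact: cvg_dot.
have /choice[M hM] n : exists M, is_mean P (fun x => s n (Z0 x)) M.
  by apply: mean_exists; exact: bsm_precomp.
have MM n : \int[P]_x dot (s n (Z i x)) (s n (Z l x)) = dot (M n) (M n).
  have [k [A [v [mA sE]]]] := simple_mapE (ss n).
  have -> : M n = \sum_(j < k) fine (P (Z0 @^-1` A j)) *: v j.
    apply: dot_inj => w; rewrite (hM n).
    have := is_mean_sum_indic P (s := fun x => s n (Z0 x)) (n := k) (v := v)
      (fun j => mpre mZ0 (mA j)) (fun x => sE (Z0 x)).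
    by move=> /(_ w) ->.
  rewrite dot_suml; transitivity (\sum_(j < k) \sum_(j' < k)
    \int[P]_x (dot (v j) (v j') * (\1_(A j) (Z i x) * \1_(A j') (Z l x)))).
    under eq_bigr => j _. 
      rewrite -expect_sum; last first.
        by move=> j'; apply: bsmM; [exact: bsm_cst|apply: bsmM; exact: bindic].
      over.
    rewrite -expect_sum; last first.
      move=> j; apply: bsm_sum => j'.
      by apply: bsmM; [exact: bsm_cst|apply: bsmM; exact: bindic].
    apply: eq_Rintegral => x _; rewrite sE dot_suml; apply: eq_bigr => j _.
    rewrite sE dot_sumr; apply: eq_bigr => j' _.
    by rewrite dotZl dotZr; ring.
  apply: eq_bigr => j _; rewrite dotZl dot_sumr mulr_sumr; apply: eq_bigr => j' _.
  rewrite expectZ; last by apply: bsmM; exact: bindic.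
  by rewrite expect_indep_indic // dotZr; ring.
have Mm : M n @[n --> \oo] --> m.
  apply/cvgrPdist_lt => e e0.
  have /cvgrPdist_lt /(_ e e0) := bsm_approx P (s := fun n x => s n (Z0 x))
    (fun n => simple_map_precomp mZ0 (ss n)) (fun n x => sC n (Z0 x))
    (fun x => sF (Z0 x)).
  apply: filterS => n; rewrite sub0r normrN; apply: le_lt_trans.
  apply: le_trans (ler_norm _); rewrite distrC.
  by apply: is_mean_dist => //; exact: bsm_precomp.
have h2 := cvg_dot Mm Mm.
move: h1; under eq_cvg do rewrite MM; move=> h1.
by apply: (cvg_unique (@Rhausdorff R) h1); exact: h2.
Qed.

(** Variance of a sample mean: the cross terms vanish by independence. *)
Lemma sample_mean_variance (H : hilbertType R) (F : U -> H) (m : H) (n : nat) :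
  (0 < n)%N -> bsm F -> is_mean P (fun x => F (Z0 x)) m ->
  \int[P]_x `|n%:R^-1 *: \sum_(i < n) F (Z i x) - m| ^+ 2 <=
  n%:R^-1 * \int[P]_x `|F (Z0 x)| ^+ 2.
Proof.
move=> n0 bF Fm; have bFi i : bsm (fun x => F (Z i x)) by exact: bsm_precomp.
have bd i l : bsm (fun x => dot (F (Z i x)) (F (Z l x)) : R) by exact: bsm_dot.
have bm i : bsm (fun x => dot m (F (Z i x)) : R).
  by apply: bsm_dot => //; exact: bsm_cst.
have nn : n%:R != 0 :> R by rewrite pnatr_eq0 -lt0n.
set e := \int[P]_x `|F (Z0 x)| ^+ 2.
pose q := dot m m.
have eE i : \int[P]_x dot (F (Z i x)) (F (Z i x)) = e.
  rewrite (expect_law (f := fun z => dot (F z) (F z))); last exact: bsm_dot.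
  by apply: eq_Rintegral => x _; rewrite dot_norm.
have mE i : \int[P]_x dot m (F (Z i x)) = q.
  rewrite (expect_law (f := fun z => dot m (F z))) -?Fm //.
  by apply: bsm_dot => //; exact: bsm_cst.
have -> : \int[P]_x `|n%:R^-1 *: \sum_(i < n) F (Z i x) - m| ^+ 2 =
    \int[P]_x (n%:R^-1 ^+ 2 * (\sum_(i < n) \sum_(l < n) dot (F (Z i x)) (F (Z l x)))
      + (-2 * n%:R^-1 * (\sum_(i < n) dot m (F (Z i x))) + q)).
  apply: eq_Rintegral => x _; rewrite norm2B -!dot_norm dotZl dotZr.
  rewrite dotZl (dotC _ m) dot_suml !dot_sumr.
  under [X in _ * (_ * X)]eq_bigr do rewrite dot_sumr.
  by rewrite /q; ring.
rewrite expectD; first last.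
- apply: bsmD; last exact: bsm_cst.
  by apply: bsmM; [exact: bsm_cst|exact: bsm_sum].
- apply: bsmM; first exact: bsm_cst.
  by apply: bsm_sum => i; exact: bsm_sum.
rewrite expectZ; last by apply: bsm_sum => i; exact: bsm_sum.
rewrite expectD; [|by apply: bsmM; [exact: bsm_cst|exact: bsm_sum]|exact: bsm_cst].
rewrite expectZ; last exact: bsm_sum.
rewrite expect_cst expect_sum; last by move=> i; exact: bsm_sum.
rewrite expect_sum //.
under eq_bigr do rewrite expect_sum //.
under [X in _ + (_ * X + _)]eq_bigr do rewrite mE.
have inner (i : 'I_n) : \sum_(l < n) \int[P]_x dot (F (Z i x)) (F (Z l x)) =
    e - q + n%:R * q.
  transitivity (\sum_(l < n) ((l == i)%:R * (e - q) + q)).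
    apply: eq_bigr => l _; have [->|li] := eqVneq l i.
      by rewrite eE mul1r subrK.
    by rewrite (expect_dot_indep (m := m)) // 1?eq_sym // mul0r add0r.
  rewrite big_split /= sumr_const card_ord mulr_natl; congr (_ + _).
  rewrite (bigD1 i) //= eqxx mul1r big1 ?addr0 // => l /negbTE ->.
  by rewrite mul0r.
under eq_bigr do rewrite inner.
rewrite !sumr_const card_ord -[(_ + _) *+ n]mulr_natl -[q *+ n]mulr_natl.
have -> : n%:R^-1 ^+ 2 * (n%:R * (e - q + n%:R * q)) +
    (-2 * n%:R^-1 * (n%:R * q) + q) = n%:R^-1 * e - n%:R^-1 * q.
  by field.
by rewrite gerBl mulr_ge0 ?invr_ge0 // dot_ge0.
Qed.

End iid_sample.

(** * Measurability of the feature map *)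

Section feature_map.
Context {R : realType} {p : nat} {O : set 'rV[R]_p} {O0 : O !=set0}.

(** A countable dense sequence: for each rational ball that meets the region,
    one of its points. *)
Lemma region_separable : exists x : nat -> region O0,
  forall (y : region O0) (A : set (region O0)), nbhs y A -> exists k, A (x k).
Proof.
pose ratv (r : 'rV[rat]_p) : 'rV[R]_p := \row_j ratr (r ord0 j).
have /choice[x hx] : forall k : nat, exists x : region O0,
    forall (r : 'rV[rat]_p) (m : nat), unpickle k = Some (r, m) ->
    (exists y : region O0, ball (ratv r) m.+1%:R^-1 (set_val y)) ->
    ball (ratv r) m.+1%:R^-1 (set_val x).
  move=> k; case uk : (unpickle k : option ('rV[rat]_p * nat)) => [[r m]|]; last first.
    by exists point.
  have [[y hy]|no] := pselect (exists y : region O0,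
      ball (ratv r) m.+1%:R^-1 (set_val y)).
    by exists y => _ _ [<- <-].
  by exists point => _ _ [<- <-] /no.
exists x => y A; rewrite nbhsE => -[B [[C oC CB] By] BA].
have Cy : C (set_val y) by rewrite -CB in By.
have /nbhs_ballP[e /= e0 eC] := open_nbhs_nbhs (conj oC Cy).
have e2 : 0 < e / 2 by rewrite divr_gt0.
have [m me] : exists m : nat, m.+1%:R^-1 < e / 2.
  have [N _ hN] := near_infty_natSinv_lt (PosNum e2).
  by exists N; apply: hN => /=.
have [r hr] : exists r : 'rV[rat]_p, ball (ratv r) m.+1%:R^-1 (set_val y).
  have m0 : 0 < m.+1%:R^-1 :> R by rewrite invr_gt0.
  have /choice[r hr] : forall j : 'I_p, exists q : rat,
      `|ratr q - set_val y ord0 j| < m.+1%:R^-1.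
    move=> j; have [|q] := @rat_in_itvoo R (set_val y ord0 j - m.+1%:R^-1)
        (set_val y ord0 j + m.+1%:R^-1).
      by rewrite ltrD2l (lt_trans _ m0) // oppr_lt0.
    by rewrite in_itv /= -ltr_distl => qy; exists q.
  exists (\row_j r j); split=> // i j; rewrite (ord1 i) /ball /= !mxE; exact: hr.
exists (pickle (r, m)); apply: BA; rewrite -CB; apply: eC.
apply: (@ball_split _ _ (ratv r)).
  by apply: le_ball (ltW me) _ _; exact: ball_sym.
by apply: le_ball (ltW me) _ _; apply: hx; [rewrite pickleK|exists y].
Qed.

Variables (kappa : region O0 -> region O0 -> R) (H : rkhs kappa).
Hypothesis kappaC : continuous_kernel kappa.
Hypothesis kappaB : bounded_kernel kappa.
Hypothesis kappa_sym : forall x y, kappa x y = kappa y x.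

Lemma dot_feature x y : dot (feature H x) (feature H y) = kappa x y.
Proof. by rewrite -reproducing featureE kappa_sym. Qed.

Lemma feature_dist2 x y :
  `|feature H x - feature H y| ^+ 2 = kappa x x - 2 * kappa x y + kappa y y.
Proof. by rewrite norm2B -!dot_norm !dot_feature. Qed.

Let kappa_cvg (T : Type) (F : set_system T) {FF : Filter F} (f g : T -> region O0)
    (x y : region O0) :
  f @ F --> x -> g @ F --> y -> kappa (f t) (g t) @[t --> F] --> kappa x y.
Proof.
move=> fx gy; apply: (@cvg_comp _ _ _ (fun t => (f t, g t)) (fun z => kappa z.1 z.2) F
  (nbhs (x, y)) (nbhs (kappa x y))); first exact: cvg_pair fx gy.
exact: (@kappaC (x, y)).
Qed.

(** [`|feature x - feature y| ^ 2 = kappa x x - 2 kappa x y + kappa y y] tends to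
    [0] as [x] tends to [y]. *)
Lemma feature_approx (y : region O0) (e : R) : 0 < e ->
  nbhs y [set x : region O0 | `|feature H x - feature H y| < e].
Proof.
move=> e0; have FF : Filter (nbhs y) by exact: nbhs_filter.
have : (fun x => `|feature H x - feature H y| ^+ 2) @ nbhs y --> (0 : R).
  under eq_fun do rewrite feature_dist2.
  have -> : 0 = kappa y y - 2 * kappa y y + kappa y y by ring.
  apply: cvgD; last exact: cvg_cst.
  apply: cvgB; first exact: kappa_cvg.
  by apply: cvgMr; apply: kappa_cvg => //; exact: cvg_cst.
move/cvgrPdist_lt => /(_ (e ^+ 2)); rewrite exprn_gt0 // => /(_ isT).
apply: filterS => x /=; rewrite sub0r normrN normrX normr_id.
by rewrite ltr_pXn2r // nnegrE // ltW.
Qed.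

Lemma open_measurable_region (A : set (region O0)) : open A -> measurable A.
Proof. exact: sub_sigma_algebra. Qed.

(** Among the first [n + 1] points of a dense sequence, the feature of one that
    is closest to [feature x]; the nearest points are found by successive
    comparisons, each of which is decided on an open set. *)
Lemma feature_bsm : bsm (feature H).
Proof.
have [M hM] := kappaB; have [x hx] := region_separable.
have normM y : `|feature H y| <= Num.sqrt M.
  have M0 : 0 <= M := le_trans (normr_ge0 _) (hM y y).
  rewrite -(@ler_pXn2r _ 2) ?nnegrE ?sqrtr_ge0 // sqr_sqrtr // -dot_norm dot_feature.
  exact: le_trans (ler_norm _) (hM y y).
pose closer j i := [set y : region O0 |
  `|feature H y - feature H (x j)| < `|feature H y - feature H (x i)|].
have mcloser j i : measurable (closer j i).
  apply: open_measurable_region.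
  pose g y := - 2 * kappa y (x j) + kappa (x j) (x j) + 2 * kappa y (x i) - kappa (x i) (x i).
  have -> : closer j i = g @^-1` [set r | r < 0].
    have cE y : (`|feature H y - feature H (x j)| < `|feature H y - feature H (x i)|) =
        (g y < 0).
      rewrite -(@ltr_pXn2r _ 2) ?nnegrE // !feature_dist2 /g -subr_lt0.
      by congr (_ < 0); ring.
    by apply/seteqP; split => y; rewrite /closer /= cE.
  have gC (y : region O0) : g @ nbhs y --> g y.
    have FF : Filter (nbhs y) by exact: nbhs_filter.
    apply: cvgB; last exact: cvg_cst.
    apply: cvgD; last by apply: cvgMr; apply: kappa_cvg => //; exact: cvg_cst.
    apply: cvgD; last exact: cvg_cst.
    by apply: cvgMr; apply: kappa_cvg => //; exact: cvg_cst.
  by apply: open_comp; [move=> y _; exact: gC|exact: open_lt].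
pose k := fix k n y := if n is n'.+1 then
  (if `[< closer n (k n' y) y >] then n else k n' y) else 0%N.
have kS n y : k n.+1 y = if `[< closer n.+1 (k n y) y >] then n.+1 else k n y by [].
have sk n : simple_map (k n).
  elim: n => [|n IH]; first exact: simple_map_cst.
  apply: (simple_map_comp2 (fun (b : bool) j => if b then n.+1 else j)
    (s := fun y => `[< closer n.+1 (k n y) y >])) => //.
  have mT : measurable [set y | closer n.+1 (k n y) y].
    rewrite [X in measurable X](_ : _ =
        \bigcup_j (k n @^-1` [set j] `&` closer n.+1 j)).
      by apply: bigcup_measurable => j _; apply: measurableI => //; case: IH.
    by apply/seteqP; split=> [y cy|y [j _ [/= <-]]] //; exists (k n y).
  split; first exact: finite_finset.
  case.
    rewrite [X in measurable X](_ : _ = [set y | closer n.+1 (k n y) y]) //.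
    by apply/seteqP; split => y /asboolP.
  rewrite [X in measurable X](_ : _ = ~` [set y | closer n.+1 (k n y) y]).
    exact: measurableC.
  apply/seteqP; split => y /=; first by move/negbT/asboolPn.
  by move=> h; apply/negbTE/asboolPn.
have kmin n y j : (j <= n)%N ->
    `|feature H y - feature H (x (k n y))| <= `|feature H y - feature H (x j)|.
  elim: n => [|n IH]; first by rewrite leqn0 => /eqP ->.
  rewrite leq_eqVlt ltnS kS; case: asboolP => [c|/negP]; last first.
    by rewrite -leNgt => c /orP[/eqP -> //|]; exact: IH.
  by case/orP => [/eqP -> //|/IH]; exact: le_trans (ltW c).
exists (Num.sqrt M), (fun n y => feature H (x (k n y))); split => // [n|y].
  exact: (simple_map_comp (fun j => feature H (x j))).
apply/cvgrPdist_lt => e e0; have [j hj] := hx y _ (feature_approx y e0).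
near=> n; apply: le_lt_trans (kmin n y j _) _; last by rewrite distrC.
by near: n; exact: nbhs_infty_ge.
Unshelve. all: by end_near. Qed.

End feature_map.

(** * Concentration of the empirical cross-covariance *)

(** Markov's inequality for the supremum of an increasing sequence: the events
    where the [m]-th member exceeds [c] increase with [m]. *)
Lemma markov_sup d (T : measurableType d) (R : realType) (P : probability T R)
    (S : nat -> T -> R) (K c : R) : 0 < c ->
  (forall m, bsm (S m)) -> (forall m x, 0 <= S m x) ->
  (forall x, {homo S^~ x : m n / (m <= n)%N >-> m <= n}) ->
  (forall m, \int[P]_x S m x <= K) ->
  exists E : set T, [/\ measurable E, (P E <= (K / c)%:E)%E &
    forall x, ~ E x -> forall m, S m x <= c].
Proof.
move=> c0 bS S0 Snd SK; pose A m := [set x | c < S m x].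
have mA m : measurable (A m).
  have := bsm_measurable (bS m) measurableT (@measurable_itv R `]c, +oo[).
  rewrite setTI; congr (measurable _); apply/seteqP.
  by split => x; rewrite /A /= in_itv /= andbT.
have PA m : (P (A m) <= (K / c)%:E)%E.
  have fin : P (A m) \is a fin_num by exact: fin_num_measure.
  rewrite -(fineK fin) lee_fin ler_pdivlMr // mulrC.
  apply: le_trans (SK m).
  rewrite -expect_indic // -expectZ; last by apply: bsm_simple; exact: simple_map_indic.
  apply: expect_le => //.
    by apply: bsmM; [exact: bsm_cst|apply: bsm_simple; exact: simple_map_indic].
  move=> x; rewrite indicE; case: (boolP (x \in A m)) => [|_]; last by rewrite mulr0.
  by rewrite inE /A /= mulr1 => /ltW.
exists (\bigcup_m A m); split.
- exact: bigcup_measurable.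
- have ndA : nondecreasing_seq A.
    move=> m n mn; apply/subsetPset => x; rewrite /A /= => h.
    exact: lt_le_trans h (Snd x _ _ mn).
  have h := nondecreasing_cvg_mu mA (bigcup_measurable (fun k _ => mA k)) ndA (mu := P).
  rewrite -(cvg_lim (@ereal_hausdorff R) h); apply: lime_le; first by apply/cvg_ex; eexists; exact: h.
  exact: nearW.
- move=> x nE m; rewrite leNgt; apply/negP => h; apply: nE; by exists m.
Qed.

Section cross_covariance.
Context {dO dU : measure_display} {Omega : measurableType dO}
  {U : measurableType dU} {R : realType}.
Variables (P : probability Omega R) (Z0 : Omega -> U) (Z : nat -> Omega -> U).
Hypothesis mZ0 : measurable_fun setT Z0.
Hypothesis mZ : forall i, measurable_fun setT (Z i).
Hypothesis iid : iid_copies P Z0 Z.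
Context {H1 H2 : hilbertType R}.
Variables (F : U -> H1) (G : U -> H2) (muF : H1) (muG : H2) (C : H2 -> H1) (B : R).
Hypotheses (bF : bsm F) (bG : bsm G).
Hypothesis meanF : is_mean P (fun x => F (Z0 x)) muF.
Hypothesis covE : forall f g, dot f (C g) =
  \int[P]_x (dot f (F (Z0 x) - muF) * dot (G (Z0 x) - muG) g).
Hypothesis GB : forall z, `|G z - muG| <= B.

Definition sample_avg (V : lmodType R) (f : U -> V) (n : nat) (x : Omega) : V :=
  n%:R^-1 *: \sum_(i < n) f (Z i x).

Definition sample_cross (n : nat) (x : Omega) (g : H2) : H1 :=
  n%:R^-1 *: \sum_(i < n) dot (G (Z i x) - sample_avg G n x) g *:
    (F (Z i x) - sample_avg F n x).

Let B0 : 0 <= B. Proof. exact: le_trans (normr_ge0 _) (GB point). Qed.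

Let u z := F z - muF.
Let v z := G z - muG.
Let bu : bsm u. Proof. by apply: bsmB => //; exact: bsm_cst. Qed.
Let bv : bsm v. Proof. by apply: bsmB => //; exact: bsm_cst. Qed.

Let bdot (H : hilbertType R) (w : H) (f : U -> H) : bsm f -> bsm (fun z => dot w (f z) : R).
Proof. by move=> bf; apply: bsm_dot => //; exact: bsm_cst. Qed.

Lemma sample_avg_center (V : lmodType R) (f : U -> V) (w : V) n x : (0 < n)%N ->
  sample_avg (fun z => f z - w) n x = sample_avg f n x - w.
Proof.
move=> n0; rewrite /sample_avg sumrB sumr_const card_ord scalerBr -(scaler_nat n w).
by rewrite scalerA mulVf ?scale1r // pnatr_eq0 -lt0n.
Qed.

Lemma sample_avg_le (V : normedModType R) (f : U -> V) (K : R) n x :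
  (0 < n)%N -> (forall z, `|f z| <= K) -> `|sample_avg f n x| <= K.
Proof.
move=> n0 fK; rewrite normrZ ger0_norm ?invr_ge0 // mulrC ler_pdivrMr ?ltr0n //.
apply: (le_trans (ler_norm_sum _ _ _)).
apply: (@le_trans _ _ (\sum_(i < n) K)); first exact: ler_sum.
by rewrite sumr_const card_ord -[K *+ n]mulr_natr.
Qed.

(** Centring at the sample means instead of the population means changes the
    empirical operator by a rank-one term only. *)
Lemma sample_crossE n x g : (0 < n)%N ->
  sample_cross n x g = n%:R^-1 *: \sum_(i < n) dot (v (Z i x)) g *: u (Z i x)
    - dot (sample_avg v n x) g *: sample_avg u n x.
Proof.
move=> n0; have nn : n%:R != 0 :> R by rewrite pnatr_eq0 -lt0n.
rewrite /u /v !sample_avg_center // /sample_cross.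
set Fb := sample_avg F n x; set Gb := sample_avg G n x.
have SF : \sum_(i < n) (F (Z i x) - muF) = n%:R *: (Fb - muF).
  rewrite /Fb -sample_avg_center // /sample_avg scalerA mulfV // scale1r //.
have SG : \sum_(i < n) (G (Z i x) - muG) = n%:R *: (Gb - muG).
  rewrite /Gb -sample_avg_center // /sample_avg scalerA mulfV // scale1r //.
have -> : \sum_(i < n) dot (G (Z i x) - Gb) g *: (F (Z i x) - Fb) =
    \sum_(i < n) dot (G (Z i x) - muG) g *: (F (Z i x) - muF)
    - n%:R *: (dot (Gb - muG) g *: (Fb - muF)).
  transitivity (\sum_(i < n) (dot (G (Z i x) - muG) g *: (F (Z i x) - muF)
     - dot (G (Z i x) - muG) g *: (Fb - muF)
     - dot (Gb - muG) g *: (F (Z i x) - muF) + dot (Gb - muG) g *: (Fb - muF))).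
    apply: eq_bigr => i _.
    have -> : F (Z i x) - Fb = (F (Z i x) - muF) - (Fb - muF).
      by rewrite opprB addrA subrK.
    have -> : G (Z i x) - Gb = (G (Z i x) - muG) - (Gb - muG).
      by rewrite opprB addrA subrK.
    move: (F (Z i x) - muF) (Fb - muF) (G (Z i x) - muG) (Gb - muG) => p1 p2 q1 q2.
    by rewrite [in LHS]dotBl scalerBl !scalerBr opprD opprK addrA.
  rewrite big_split !sumrB /= -scaler_sumr SF -scaler_suml -dot_suml SG.
  rewrite sumr_const card_ord -[(_ *: _) *+ n]scaler_nat dotZl !scalerA.
  by rewrite (mulrC _ n%:R) subrK.
by rewrite scalerBr (scalerA n%:R^-1 n%:R) mulVf // scale1r.
Qed.


(** Such an [f] annihilates every difference of the features of the sample. *)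
Lemma sample_cross_orth (f : H1) (c : R) n x g : (0 < n)%N ->
  (forall i, (i < n)%N -> dot f (F (Z i x)) = c) -> dot f (sample_cross n x g) = 0.
Proof.
move=> n0 fc; have fF (i : 'I_n) : dot f (F (Z i x)) = c by exact: fc.
have avg : dot f (sample_avg F n x) = c.
  rewrite dotZr dot_sumr (eq_bigr (fun=> c)) // sumr_const card_ord -[c *+ n]mulr_natl.
  by rewrite mulrA mulVf ?mul1r // pnatr_eq0 -lt0n.
rewrite dotZr dot_sumr big1 ?mulr0 // => i _.
by rewrite dotZr dotBr fF avg subrr mulr0.
Qed.

(** A bound for the square of the vector that represents
    [g |-> dot w (sample_cross n x g - C g)]. The second term comes from the
    recentring of the sample; it is written with [dot w u *: w], of the same norm
    as [dot w u] for a unit vector [w], so that the variance of a sample mean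
    of Hilbert-valued maps applies to both terms. *)
Definition direction_error (w : H1) (m : H2) (n : nat) (x : Omega) : R :=
  2 * `|n%:R^-1 *: \sum_(i < n) dot w (u (Z i x)) *: v (Z i x) - m| ^+ 2 +
  2 * B ^+ 2 * `|n%:R^-1 *: \sum_(i < n) dot w (u (Z i x)) *: w - 0| ^+ 2.

Let bxi (w : H1) : bsm (fun z => dot w (u z) *: v z).
Proof. by apply: bsmZ => //; exact: bdot. Qed.

Let bproj (w : H1) : bsm (fun z => dot w (u z) *: w).
Proof. by apply: bsmZ; [exact: bdot|exact: bsm_cst]. Qed.

Let bavg (H : hilbertType R) (f : U -> H) (m : H) n : bsm f ->
  bsm (fun x => `|n%:R^-1 *: \sum_(i < n) f (Z i x) - m| ^+ 2 : R).
Proof.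
move=> bf; have bS : bsm (fun x => `|n%:R^-1 *: \sum_(i < n) f (Z i x) - m| : R).
  apply/bsm_norm/bsmB; last exact: bsm_cst.
  apply: bsmZ; first exact: bsm_cst.
  by apply: bsm_sum => i; exact: bsm_precomp.
by under eq_fun do rewrite expr2; exact: bsmM.
Qed.

Lemma bsm_direction_error w m n : bsm (direction_error w m n).
Proof.
apply: bsmD; (apply: bsmM; first exact: bsm_cst).
  exact: (bavg m n (bxi w)).
exact: (bavg 0 n (bproj w)).
Qed.

Lemma dot_sample_cross_error (w : H1) (m : H2) n x g : (0 < n)%N -> `|w| = 1 ->
  is_mean P (fun x => dot w (u (Z0 x)) *: v (Z0 x)) m ->
  dot w (sample_cross n x g - C g) ^+ 2 <= direction_error w m n x * `|g| ^+ 2.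
Proof.
move=> n0 w1 hm.
pose t := (n%:R^-1 *: \sum_(i < n) dot w (u (Z i x)) *: v (Z i x) - m)
  - dot w (sample_avg u n x) *: sample_avg v n x.
have mE : dot w (C g) = dot g m.
  rewrite covE hm; apply: eq_Rintegral => y _.
  by rewrite dotZr [dot g _]dotC.
have -> : dot w (sample_cross n x g - C g) = dot t g.
  rewrite sample_crossE // 2!dotBr mE /t 2!dotBl (dotC g).
  have -> : dot w (n%:R^-1 *: \sum_(i < n) dot (v (Z i x)) g *: u (Z i x)) =
      dot (n%:R^-1 *: \sum_(i < n) dot w (u (Z i x)) *: v (Z i x)) g.
    rewrite dotZr dotZl dot_suml dot_sumr; congr (_ * _); apply: eq_bigr => i _.
    by rewrite dotZr dotZl mulrC.
  rewrite [dot w (_ *: _)]dotZr [dot (dot w _ *: _) g]dotZl; ring.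
have tE : `|t| ^+ 2 <= direction_error w m n x.
  set a := n%:R^-1 *: \sum_(i < n) dot w (u (Z i x)) *: v (Z i x) - m.
  have tle : `|t| <= `|a| + B * `|dot w (sample_avg u n x)|.
    rewrite (le_trans (ler_normB _ _)) // lerD2l normrZ mulrC ler_wpM2r //.
    exact: sample_avg_le.
  have -> : direction_error w m n x =
      2 * `|a| ^+ 2 + 2 * B ^+ 2 * `|dot w (sample_avg u n x)| ^+ 2.
    rewrite /direction_error -/a subr0; congr (_ + _ * _ ^+ 2).
    rewrite -scaler_suml scalerA normrZ w1 mulr1; congr (`|_|).
    by rewrite /sample_avg dotZr dot_sumr.
  have := sqr_ge0 (`|a| - B * `|dot w (sample_avg u n x)|).
  have : `|t| ^+ 2 <= (`|a| + B * `|dot w (sample_avg u n x)|) ^+ 2.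
    by rewrite lerXn2r ?nnegrE // addr_ge0 // mulr_ge0.
  rewrite sqrrB sqrrD exprMn; lra.
apply: (@le_trans _ _ (`|t| ^+ 2 * `|g| ^+ 2)); last by rewrite ler_wpM2r ?sqr_ge0.
rewrite -exprMn -[X in X <= _]real_normK ?num_real // lerXn2r ?nnegrE ?mulr_ge0 //.
exact: cauchy_schwarz.
Qed.

Lemma expect_direction_error (w : H1) (m : H2) n : (0 < n)%N -> `|w| = 1 ->
  is_mean P (fun x => dot w (u (Z0 x)) *: v (Z0 x)) m ->
  \int[P]_x direction_error w m n x <=
  4 * B ^+ 2 * (n%:R^-1 * \int[P]_x (dot w (u (Z0 x)) ^+ 2)).
Proof.
move=> n0 w1 hm.
have hw : is_mean P (fun x => dot w (u (Z0 x)) *: w) 0.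
  move=> f; rewrite dot0r; under eq_Rintegral do rewrite dotZr mulrC.
  have bw : bsm (fun x => dot w (F (Z0 x)) : R).
    by apply: (bsm_precomp (F := fun z => dot w (F z))) => //; exact: bdot.
  rewrite expectZ; last by apply: (bsm_precomp (F := fun z => dot w (u z))) => //; exact: bdot.
  under eq_Rintegral do rewrite /u dotBr.
  by rewrite expectB ?expect_cst -?meanF ?subrr ?mulr0 //; exact: bsm_cst.
rewrite expectD; first last.
- by apply: bsmM; [exact: bsm_cst|exact: (bavg 0 n (bproj w))].
- by apply: bsmM; [exact: bsm_cst|exact: (bavg m n (bxi w))].
rewrite (expectZ P 2 (bavg m n (bxi w))) (expectZ P (2 * B ^+ 2) (bavg 0 n (bproj w))).
have h1 := sample_mean_variance mZ0 mZ iid n0 (bxi w) hm.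
have h2 := sample_mean_variance mZ0 mZ iid n0 (bproj w) hw.
have bdot2 : bsm (fun x => dot w (u (Z0 x)) ^+ 2 : R).
  apply: (bsm_precomp (F := fun z => dot w (u z) ^+ 2)) => //.
  by under eq_fun do rewrite expr2; apply: bsmM; exact: bdot.
have bnorm2 (f : U -> H2) : bsm f -> bsm (fun x => `|f (Z0 x)| ^+ 2 : R).
  move=> bf; apply: (bsm_precomp (F := fun z => `|f z| ^+ 2)) => //.
  by under eq_fun do rewrite expr2; apply: bsmM; exact: bsm_norm.
have h3 : \int[P]_x `|dot w (u (Z0 x)) *: v (Z0 x)| ^+ 2 <=
    B ^+ 2 * \int[P]_x (dot w (u (Z0 x)) ^+ 2).
  rewrite -expectZ //; apply: expect_le.
  - exact: (bnorm2 _ (bxi w)).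
  - by apply: bsmM => //; exact: bsm_cst.
  move=> x; rewrite normrZ exprMn real_normK ?num_real // mulrC ler_wpM2r ?sqr_ge0 //.
  by rewrite lerXn2r ?nnegrE //; exact: GB.
have h4 : \int[P]_x `|dot w (u (Z0 x)) *: w| ^+ 2 = \int[P]_x (dot w (u (Z0 x)) ^+ 2).
  apply: eq_Rintegral => x _.
  by rewrite normrZ w1 mulr1 real_normK ?num_real.
have ni : 0 <= n%:R^-1 :> R by rewrite invr_ge0.
have h5 := le_trans h1 (ler_wpM2l ni h3).
rewrite h4 in h2.
have h6 := ler_wpM2l (sqr_ge0 B) h2.
set I := \int[P]_x (dot w (u (Z0 x)) ^+ 2) in h5 h6 *.
apply: (@le_trans _ _ (2 * (n%:R^-1 * (B ^+ 2 * I)) + 2 * (B ^+ 2 * (n%:R^-1 * I)))).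
  rewrite -(mulrA 2 (B ^+ 2)); apply: lerD; rewrite ler_pM2l //.
by rewrite le_eqVlt; apply/orP; left; apply/eqP; ring.
Qed.

Variables (lam : nat -> R) (phi : nat -> H1).
Hypothesis phi1 : forall j, 0 < lam j -> `|phi j| = 1.
Hypothesis phi_var : forall j, 0 < lam j ->
  \int[P]_x (dot (phi j) (u (Z0 x)) ^+ 2) = lam j.

(** The event does not depend on [g]: Markov's inequality is applied to the
    weighted sum of the squared norms of the representing vectors. *)
Lemma sample_cross_concentration (a : nat -> R) (K c : R) (n : nat) :
  (0 < n)%N -> 0 < c -> (forall j, 0 <= a j) ->
  (forall m, \sum_(0 <= j < m | 0 < lam j) a j * lam j <= K) ->
  exists E : set Omega, [/\ measurable E,
    (P E <= (4 * B ^+ 2 * (n%:R^-1 * K) / c)%:E)%E &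
    forall x, ~ E x -> forall m g,
      \sum_(0 <= j < m | 0 < lam j) a j * dot (phi j) (sample_cross n x g - C g) ^+ 2 <=
      c * `|g| ^+ 2].
Proof.
move=> n0 c0 a0 aK.
have /choice[mm hm] : forall j, exists m, is_mean P (fun x => dot (phi j) (u (Z0 x)) *: v (Z0 x)) m.
  by move=> j; apply: mean_exists; exact: (bsm_precomp (F := fun z => dot (phi j) (u z) *: v z)).
pose S m x := \sum_(0 <= j < m | 0 < lam j) a j * direction_error (phi j) (mm j) n x.
have q0 j x : 0 <= direction_error (phi j) (mm j) n x.
  by rewrite addr_ge0 // mulr_ge0 ?sqr_ge0 // mulr_ge0 ?sqr_ge0.
have ba j : bsm (fun x => a j * direction_error (phi j) (mm j) n x).
  by apply: bsmM; [exact: bsm_cst|exact: bsm_direction_error].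
have [||||E [mE PE hE]] := @markov_sup _ _ _ P S (4 * B ^+ 2 * (n%:R^-1 * K)) c c0.
- by move=> m; exact: bsm_sum.
- by move=> m x; apply: sumr_ge0 => j _; rewrite mulr_ge0.
- move=> x i m im; rewrite /S [leRHS](big_cat_nat (n := i)) //= lerDl.
  by apply: sumr_ge0 => j _; rewrite mulr_ge0.
- move=> m; rewrite /S expect_sum //.
  apply: (@le_trans _ _ (\sum_(0 <= j < m | 0 < lam j)
      (4 * B ^+ 2 * n%:R^-1) * (a j * lam j))).
    apply: ler_sum => j lj; rewrite expectZ; last exact: bsm_direction_error.
    rewrite [leRHS]mulrCA ler_wpM2l // -[X in _ * X](phi_var lj) -(mulrA (4 * B ^+ 2)).
    by apply: expect_direction_error; [|exact: phi1|exact: hm].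
  by rewrite -mulr_sumr -mulrA ler_wpM2l // ?mulr_ge0 ?sqr_ge0 // ler_wpM2l // invr_ge0.
exists E; split => // x nE m g; apply: le_trans (ler_wpM2r (sqr_ge0 `|g|) (hE x nE m)).
rewrite /S mulr_suml; apply: ler_sum => j lj; rewrite -mulrA ler_wpM2l //.
by apply: dot_sample_cross_error; [|exact: phi1|exact: hm].
Qed.

End cross_covariance.

(** * The covariance operator and its kernel *)

(** Cauchy-Schwarz in the degenerate case, from [|a b| <= a ^ 2 / e + e K ^ 2]
    for every [e > 0], where [K] bounds [b]. *)
Lemma expect_mul_sq0 d (T : measurableType d) (R : realType)
    (P : probability T R) (a b : T -> R) : bsm a -> bsm b ->
  \int[P]_x (a x ^+ 2) = 0 -> \int[P]_x `|a x * b x| = 0.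
Proof.
move=> ba bb a0; have [K K0 bK] := bsm_bounded bb.
set I := \int[P]_x `|_|.
have I0 : 0 <= I by apply: Rintegral_ge0.
have b2 : bsm (fun x => a x ^+ 2).
  by under eq_fun do rewrite expr2; exact: bsmM.
have key e : 0 < e -> I <= K ^+ 2 * e.
  move=> e0.
  have -> : K ^+ 2 * e = \int[P]_x (e^-1 * a x ^+ 2 + K ^+ 2 * e).
    rewrite expectD ?expect_cst ?expectZ ?a0 ?mulr0 ?add0r //.
      by apply: bsmM => //; exact: bsm_cst.
    exact: bsm_cst.
  apply: expect_le; first exact/bsm_norm/bsmM.
    by apply: bsmD; [apply: bsmM => //; exact: bsm_cst|exact: bsm_cst].
  move=> x; rewrite normrM.
  have h1 := ler_wpM2l (normr_ge0 (a x)) (bK x).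
  have h2 : 0 <= e^-1 * (`|a x| - K * e) ^+ 2 by rewrite mulr_ge0 ?sqr_ge0 // invr_ge0 ltW.
  have h3 : e^-1 * (`|a x| - K * e) ^+ 2 = e^-1 * a x ^+ 2 - 2 * (`|a x| * K) + K ^+ 2 * e.
    by rewrite sqrrB real_normK ?num_real //; field; rewrite gt_eqF.
  have h4 : 0 <= `|a x| * K by rewrite mulr_ge0.
  lra.
apply/eqP; rewrite eq_le I0 andbT; apply/ler_addgt0Pr => e e0; rewrite add0r.
have h := key (e / (K ^+ 2 + 1)); rewrite divr_gt0 ?ltr_wpDl ?sqr_ge0 // in h.
apply: le_trans (h isT) _; rewrite mulrA ler_pdivrMr ?ltr_wpDl ?sqr_ge0 //.
by rewrite mulrC ler_pM2l // lerDl.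
Qed.

Section covariance.
Context {dO dU : measure_display} {Omega : measurableType dO}
  {U : measurableType dU} {R : realType}.
Variables (P : probability Omega R) (Z0 : Omega -> U).
Hypothesis mZ0 : measurable_fun setT Z0.

Section cross.
Context {H1 H2 : hilbertType R}.
Variables (F : U -> H1) (G : U -> H2) (muF : H1) (muG : H2) (C : H2 -> H1).
Variables (BF BG : R).
Hypotheses (bF : bsm F) (bG : bsm G).
Hypothesis covE : forall f g, dot f (C g) =
  \int[P]_x (dot f (F (Z0 x) - muF) * dot (G (Z0 x) - muG) g).
Hypothesis FB : forall z, `|F z - muF| <= BF.
Hypothesis GB : forall z, `|G z - muG| <= BG.

Let bu : bsm (fun x => F (Z0 x) - muF).
Proof. by apply: bsmB; [exact: bsm_precomp|exact: bsm_cst]. Qed.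

Let bv : bsm (fun x => G (Z0 x) - muG).
Proof. by apply: bsmB; [exact: bsm_precomp|exact: bsm_cst]. Qed.

Let bprod f g : bsm (fun x => dot f (F (Z0 x) - muF) * dot (G (Z0 x) - muG) g : R).
Proof.
by apply: bsmM; apply: bsm_dot => //; exact: bsm_cst.
Qed.

Lemma cross_linear : linear C.
Proof.
move=> a g h; apply: dot_inj => f; rewrite dotDr dotZr !covE -expectZ // -expectD //.
  apply: eq_Rintegral => x _.
  by rewrite [dot _ (a *: g + h)]dotDr [dot _ (a *: g)]dotZr; ring.
by apply: bsmM => //; exact: bsm_cst.
Qed.

Lemma cross_le g : `|C g| <= BF * BG * `|g|.
Proof.
have BF0 : 0 <= BF := le_trans (normr_ge0 _) (FB point).
have BG0 : 0 <= BG := le_trans (normr_ge0 _) (GB point).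
apply: norm_le_dot => [|f]; first by rewrite !mulr_ge0.
rewrite covE -[leRHS](expect_cst P); apply: expect_le => //; first exact: bsm_cst.
move=> x; rewrite (le_trans (ler_norm _)) // normrM mulrC.
apply: (@le_trans _ _ ((BG * `|g|) * (`|f| * BF))); last first.
  by rewrite le_eqVlt; apply/orP; left; apply/eqP; ring.
apply: ler_pM => //.
  by rewrite (le_trans (cauchy_schwarz _ _)) // ler_wpM2r.
by rewrite (le_trans (cauchy_schwarz _ _)) // ler_wpM2l.
Qed.

(** [dot f u] vanishes almost surely, hence so does its product with anything. *)
Lemma cross_zero_variance f g :
  \int[P]_x (dot f (F (Z0 x) - muF) ^+ 2) = 0 -> dot f (C g) = 0.
Proof.
move=> f0; rewrite covE; apply/eqP; rewrite -normr_le0.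
apply: le_trans (expect_abs _ (bprod f g)) _.
rewrite (expect_mul_sq0 (a := fun x => dot f (F (Z0 x) - muF))) //.
- by apply: bsm_dot => //; exact: bsm_cst.
- by apply: bsm_dot => //; exact: bsm_cst.
Qed.

End cross.

Section self.
Context {H : hilbertType R}.
Variables (F : U -> H) (mu : H) (A : H -> H).
Hypothesis bF : bsm F.
Hypothesis covE : forall f g, dot f (A g) =
  \int[P]_x (dot f (F (Z0 x) - mu) * dot (F (Z0 x) - mu) g).

Let u z := F z - mu.
Let bu : bsm u. Proof. by apply: bsmB; [|exact: bsm_cst]. Qed.

Lemma cov_sym f g : dot f (A g) = dot (A f) g.
Proof.
rewrite [RHS]dotC !covE; apply: eq_Rintegral => x _.
by rewrite [LHS]mulrC [dot f _]dotC [dot g _]dotC.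
Qed.

Lemma cov_quadratic f : dot f (A f) = \int[P]_x (dot f (u (Z0 x)) ^+ 2).
Proof. by rewrite covE; apply: eq_Rintegral => x _; rewrite expr2 [dot _ f]dotC. Qed.

Lemma cov_pos f : 0 <= dot f (A f).
Proof. by rewrite cov_quadratic; apply: Rintegral_ge0 => x _; rewrite sqr_ge0. Qed.

Lemma cov_ker f : A f = 0 -> \int[P]_x (dot f (u (Z0 x)) ^+ 2) = 0.
Proof. by move=> Af; rewrite -cov_quadratic Af dot0r. Qed.

Variables (lam : nat -> R) (phi : nat -> H).
Hypothesis Aspec : spectral_decomposition A lam phi.

Let Alin : linear A. Proof. exact: cross_linear covE. Qed.

Let Q y := y - eigen_proj lam phi y.

Let AQ y : A (Q y) = 0. Proof. exact: ker_coproj. Qed.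

Let QB y z : Q y - Q z = Q (y - z).
Proof.
by rewrite /Q (eigen_projB Aspec) !opprD !opprK [LHS]addrACA.
Qed.

Let Qle y : `|Q y| <= `|y|. Proof. by apply: (coproj_le (A := A)) => //; exact: cov_sym. Qed.

Let Qcvg (y : nat -> H) z : y @ \oo --> z -> Q (y n) @[n --> \oo] --> Q z.
Proof.
move=> yz; apply/cvgrPdist_lt => e e0.
have /cvgrPdist_lt /(_ e e0) := yz; apply: filterS => n.
by apply: le_lt_trans; rewrite QB.
Qed.

(** The kernel of the covariance operator need not be separable, so that
    [dot f u = 0] a.s. for each [f] of the kernel does not immediately give one
    null set. Approximating [u] by simple maps [s] does: [E |Q u| ^ 2] is the
    limit of [E dot (Q s) u], which vanishes because [s] takes finitely many
    values. *)
Lemma coproj_variance0 : \int[P]_x (`|Q (u (Z0 x))| ^+ 2) = 0.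
Proof.
have [C [s [ss sC su]]] := bu.
have [D D0 uD] := bsm_bounded bu.
have h1 : \int[P]_x dot (Q (s n (Z0 x))) (u (Z0 x)) @[n --> \oo] -->
    \int[P]_x dot (Q (u (Z0 x))) (u (Z0 x)).
  apply: (@expect_cvg _ _ _ _ _ _ (C * D)).
  - move=> n; apply: bsm_dot; last exact: bsm_precomp.
    by apply: bsm_simple; apply: simple_map_comp; exact: simple_map_precomp.
  - move=> n x; rewrite (le_trans (cauchy_schwarz _ _)) // ler_pM //.
    exact: le_trans (Qle _) (sC _ _).
  - by move=> x; apply: cvg_dot; [exact: Qcvg|exact: cvg_cst].
have zero n : \int[P]_x dot (Q (s n (Z0 x))) (u (Z0 x)) = 0.
  have [fins _] := ss n.
  pose l : seq H := finmap.enum_fset (fset_set (range (s n))).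
  have lE z : s n z \in l by rewrite in_fset_set // inE; exists z.
  have bk f : bsm (fun x => `|dot f (u (Z0 x))| : R).
    apply: bsm_norm; apply: bsm_dot; [exact: bsm_cst|exact: bsm_precomp].
  apply/eqP; rewrite -normr_le0; apply: le_trans (expect_abs _ _) _.
    apply: bsm_dot; last exact: bsm_precomp.
    by apply: bsm_simple; apply: simple_map_comp; exact: simple_map_precomp.
  apply: (@le_trans _ _ (\int[P]_x (\sum_(v <- l) `|dot (Q v) (u (Z0 x))|))).
    apply: expect_le; [|exact: bsm_sum|].
      apply: bsm_norm; apply: bsm_dot; last exact: bsm_precomp.
      by apply: bsm_simple; apply: simple_map_comp; exact: simple_map_precomp.
    move=> x; rewrite (big_rem _ (lE (Z0 x))) /= lerDl.
    exact: sumr_ge0.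
  rewrite expect_sum // big1 // => v _.
  under eq_Rintegral do rewrite -[dot _ _]mulr1.
  rewrite expect_mul_sq0 //; [|exact: bsm_cst|exact: cov_ker].
  by apply: bsm_dot; [exact: bsm_cst|exact: bsm_precomp].
move: h1; under eq_cvg do rewrite zero; move=> h1.
have e : \int[P]_x dot (Q (u (Z0 x))) (u (Z0 x)) = 0.
  by apply: (cvg_unique (@Rhausdorff R) h1); exact: cvg_cst.
rewrite -[RHS]e; apply: eq_Rintegral => x _.
by rewrite -dot_norm {2}/Q (proj_orth cov_sym Aspec) // AQ.
Qed.

Variable Z : nat -> Omega -> U.
Hypothesis mZ : forall i, measurable_fun setT (Z i).
Hypothesis iid : iid_copies P Z0 Z.

(** Markov's inequality for the multiples [m * sum_i |Q u_i| ^ 2], all of mean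
    zero, gives a measurable null event outside which the sum vanishes. *)
Lemma kernel_null_event (n : nat) : exists E : set Omega, [/\ measurable E,
  (P E <= 0)%E & forall x, ~ E x -> forall i f, (i < n)%N -> A f = 0 ->
    dot f (u (Z i x)) = 0].
Proof.
have bQ : bsm (fun z => `|Q (u z)| ^+ 2 : R).
  have bQ : bsm (fun z => Q (u z)).
    apply: (@bsm_comp _ _ _ H H Q) => //.
    by move=> C; exists C => v vC; exact: le_trans (Qle v) vC.
  by under eq_fun do rewrite expr2; apply: bsmM; exact: bsm_norm.
have bQi i : bsm (fun x => `|Q (u (Z i x))| ^+ 2 : R).
  exact: (bsm_precomp (F := fun z => `|Q (u z)| ^+ 2)).
have sum0 x : 0 <= \sum_(i < n) `|Q (u (Z i x))| ^+ 2.
  by apply: sumr_ge0 => i _; rewrite sqr_ge0.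
have [||||E [mE PE hE]] := @markov_sup _ _ _ P
  (fun m x => m%:R * \sum_(i < n) `|Q (u (Z i x))| ^+ 2) 0 1 ltr01.
- by move=> m; apply: bsmM; [exact: bsm_cst|exact: bsm_sum].
- by move=> m x; rewrite mulr_ge0.
- by move=> x m m' mm'; rewrite ler_wpM2r // ler_nat.
- move=> m; rewrite expectZ; last exact: bsm_sum.
  rewrite expect_sum // big1 ?mulr0 // => i _.
  by rewrite (expect_law mZ0 mZ iid _ bQ) coproj_variance0.
rewrite mul0r in PE.
exists E; split => // x nE i f lt_in Af.
have Q0 : Q (u (Z i x)) = 0.
  apply/eqP; rewrite -normr_eq0 -sqrf_eq0 eq_le sqr_ge0 andbT.
  have S0 : \sum_(i < n) `|Q (u (Z i x))| ^+ 2 <= 0.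
    rewrite leNgt; apply/negP => S0; have := hE x nE (Num.trunc (\sum_(i < n) `|Q (u (Z i x))| ^+ 2)^-1).+1.
    apply/negP; rewrite -ltNge -ltr_pdivrMr // mul1r.
    by have /andP[_] := truncn_itv (ltW (etrans (invr_gt0 _) S0)).
  apply: le_trans S0; rewrite (bigD1 (Ordinal lt_in)) //= lerDl.
  by apply: sumr_ge0 => j _; rewrite sqr_ge0.
rewrite -(proj_orth cov_sym Aspec _ Af).
by rewrite -/(Q (u (Z i x))) Q0 dot0r.
Qed.

End self.
End covariance.

(** * Decomposition of the estimation error *)

Section inverses.
Context {R : realType} {H : hilbertType R}.

Lemma coercive_norm_le (A : H -> H) (e : R) x : 0 < e ->
  (forall x, 0 <= dot x (A x)) -> `|x| <= e^-1 * `|A x + e *: x|.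
Proof.
move=> e0 Apos; rewrite ler_pdivlMl //.
have [->|x0] := eqVneq x 0; first by rewrite normr0 mulr0.
rewrite -(@ler_pM2l _ `|x|) ?normr_gt0 //.
apply: le_trans (dot_le _ _); rewrite dotDr dotZr dot_norm.
by rewrite mulrCA -expr2 lerDr.
Qed.

Lemma operator_invK (B : H -> H) : injective B -> forall x, operator_inv B (B x) = x.
Proof. by move=> Binj x; rewrite /operator_inv pinvKV ?inE //; move=> y z _ _; exact: Binj. Qed.

Lemma coercive_inj (A : H -> H) (e : R) : linear A -> 0 < e ->
  (forall x, 0 <= dot x (A x)) -> injective (fun x => A x + e *: x).
Proof.
move=> Alin e0 Apos x y /= xy; apply/eqP; rewrite -subr_eq0 -normr_le0.
apply: le_trans (coercive_norm_le _ e0 Apos) _.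
rewrite (linB Alin) scalerBr addrACA -opprD xy subrr normr0 mulr0 //.
Qed.

Lemma moore_penroseK (A : H -> H) x : linear A ->
  orthogonal_compl (operator_ker A) x -> moore_penrose A (A x) = x.
Proof.
move=> Alin Vx; rewrite /moore_penrose pinvKV //; last by rewrite inE.
move=> y z; rewrite !inE => Vy Vz yz; apply/eqP.
rewrite -subr_eq0 -normr_eq0 -sqrf_eq0 -dot_norm dotBl.
have k : operator_ker A (y - z) by rewrite /operator_ker /= (linB Alin) yz subrr.
by rewrite Vy // Vz // subrr.
Qed.

End inverses.

Section error_decomposition.
Context {R : realType} {H1 H2 : hilbertType R}.
Variables (A An : H1 -> H1) (C Cn Rg : H2 -> H1) (lam : nat -> R) (phi : nat -> H1).
Variables (M Mn e a b r s : R).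
Hypotheses (Alin : linear A) (AM : forall x, `|A x| <= M * `|x|)
  (Asym : forall x y, dot x (A y) = dot (A x) y)
  (Aspec : spectral_decomposition A lam phi) (Apos : forall x, 0 <= dot x (A x)).
Hypotheses (Anlin : linear An) (AnM : forall x, `|An x| <= Mn * `|x|)
  (Anpos : forall x, 0 <= dot x (An x)).
Hypotheses (e0 : 0 < e) (a0 : 0 <= a) (b0 : 0 <= b) (r0 : 0 <= r).
Hypothesis normal_eq : forall x, A (Rg x) = C x.
Hypothesis Rgr : forall x, `|Rg x| <= r * `|x|.
Hypothesis dCV : forall f x, A f = 0 -> dot f (Cn x - C x) = 0.
Hypothesis dAV : forall f x, A f = 0 -> dot f (An x - A x) = 0.
Hypothesis dA : forall m x,
  \sum_(0 <= j < m | 0 < lam j) 1 * dot (phi j) (An x - A x) ^+ 2 <= b ^+ 2 * `|x| ^+ 2.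
Hypothesis dAe : forall m x, \sum_(0 <= j < m | 0 < lam j)
  (lam j + e)^-1 ^+ 2 * dot (phi j) (An x - A x) ^+ 2 <= a ^+ 2 * `|x| ^+ 2.
Hypothesis dCe : forall m x, \sum_(0 <= j < m | 0 < lam j)
  (lam j + e)^-1 ^+ 2 * dot (phi j) (Cn x - C x) ^+ 2 <= a ^+ 2 * `|x| ^+ 2.
Hypothesis source : forall x, exists2 z, A z + e *: z = e *: Rg x & `|z| <= s * `|x|.

(** When [(A + e) z = Cn x - C x - (An - A) (Rg x) - e (Rg x)], then
    [(An + e) (Rn x - Rg x - z) = - (An - A) z]: the empirical resolvent is
    needed only against [(An - A) z], where the crude bound [1 / e] suffices. *)
Lemma regularized_error x :
  `|operator_inv (fun f => An f + e *: f) (Cn x) - Rg x| <=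
  (1 + b / e) * (a + a * r + s) * `|x|.
Proof.
have [f Bf] := coercive_surj Anlin AnM Anpos e0 (Cn x).
rewrite -Bf (operator_invK (coercive_inj Anlin e0 Anpos)).
have [z1 z1E z1a] : exists2 z, A z + e *: z = Cn x - C x & `|z| <= a * `|x|.
  apply: (resolvent_bound Alin AM Asym Aspec Apos) => //; first exact: mulr_ge0.
    by move=> g Ag; exact: dCV.
  move=> m; rewrite [leRHS]exprMn; apply: le_trans (dCe m x).
  by apply: ler_sum => j _; rewrite exprMn.
have [z2 z2E z2a] : exists2 z, A z + e *: z = An (Rg x) - A (Rg x) & `|z| <= a * `|Rg x|.
  apply: (resolvent_bound Alin AM Asym Aspec Apos) => //; first exact: mulr_ge0.
    by move=> g Ag; exact: dAV.
  move=> m; rewrite [leRHS]exprMn; apply: le_trans (dAe m (Rg x)).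
  by apply: ler_sum => j _; rewrite exprMn.
have [z3 z3E z3s] := source x.
pose z := z1 - z2 - z3.
have dAz g : `|An g - A g| <= b * `|g|.
  rewrite -(@ler_pXn2r _ 2) ?nnegrE ?mulr_ge0 // [leRHS]exprMn.
  apply: (parseval_le Asym Aspec) => [k Ak|m]; first exact: dAV.
  by apply: le_trans (dA m g); apply: ler_sum => j _; rewrite mul1r.
have zE : A z + e *: z = Cn x - C x - (An (Rg x) - A (Rg x)) - e *: Rg x.
  rewrite -z1E -z2E -z3E /z !(linB Alin) !scalerBr !opprD !addrA.
  by rewrite [LHS](ACl (1*4*2*5*3*6)).
have zle : `|z| <= (a + a * r + s) * `|x|.
  rewrite /z (le_trans (ler_normB _ _)) // mulrDl lerD //.
  rewrite (le_trans (ler_normB _ _)) // mulrDl lerD //.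
  by rewrite (le_trans z2a) // -mulrA ler_wpM2l.
clearbody z.
have wE : An (f - Rg x - z) + e *: (f - Rg x - z) = - (An z - A z).
  have -> : An (f - Rg x - z) + e *: (f - Rg x - z) =
     (An f + e *: f) - An (Rg x) - e *: Rg x - (An z + e *: z).
    rewrite !(linB Anlin) !scalerBr !opprD !addrA.
    by rewrite [LHS](ACl (1*4*2*5*3*6)).
  rewrite Bf.
  have -> : An z + e *: z = (An z - A z) + (A z + e *: z) by rewrite addrA subrK.
  rewrite zE normal_eq -[RHS]add0r opprD addrA [LHS]addrAC; congr (_ + _).
  rewrite !opprD !opprK !addrA.
  by rewrite [LHS](ACl ((1*4)*(2*6)*(3*8)*(5*7))) /= subrr addNr addNr subrr !addr0.
have -> : f - Rg x = (f - Rg x - z) + z by rewrite subrK.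
apply: le_trans (ler_normD _ _) _.
have w_le : `|f - Rg x - z| <= b / e * `|z|.
  apply: le_trans (coercive_norm_le _ e0 Anpos) _.
  by rewrite wE normrN mulrC mulrAC ler_wpM2r // invr_ge0 ltW.
apply: (@le_trans _ _ ((1 + b / e) * `|z|)).
  by rewrite mulrDl mul1r addrC lerD2l.
by rewrite -mulrA ler_wpM2l // addr_ge0 // divr_ge0 // ltW.
Qed.

End error_decomposition.

(** The series is read off coordinate by coordinate; the indices with [lam = 0],
    where [phi] is any vector of the kernel, contribute nothing as [0 ^ s = 0]. *)
Lemma dot_operator_power (R : realType) (H : hilbertType R) (A B : H -> H)
    (s : R) (lam : nat -> R) (phi : nat -> H) x j :
  s != 0 -> spectral_decomposition A lam phi ->
  series (fun j => (lam j `^ s * dot (phi j) x) *: phi j) @ \oo --> B x ->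
  0 < lam j -> dot (phi j) (B x) = lam j `^ s * dot (phi j) x.
Proof.
move=> s0 [lam0 orth _ _] Bx lj.
have h1 := cvg_dot (cvg_cst (phi j)) Bx.
have h2 : dot (phi j) (series (fun j => (lam j `^ s * dot (phi j) x) *: phi j) n)
    @[n --> \oo] --> lam j `^ s * dot (phi j) x.
  apply: cvg_near_cst; near=> n; rewrite /series /= dot_sumr.
  have jn : (j < n)%N by near: n; exact: nbhs_infty_gt.
  rewrite (bigD1_seq j) ?mem_index_iota ?iota_uniq //= dotZr orth // eqxx mulr1.
  rewrite big1 ?addr0 // => i ij; rewrite dotZr.
  have := lam0 i; rewrite le_eqVlt => /orP[/eqP <-|li].
    by rewrite powR0 // mul0r mul0r.
  by rewrite orth // eq_sym (negbTE ij) mulr0.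
by apply: (cvg_unique (@Rhausdorff R) _ h2); exact: h1.
Unshelve. all: by end_near. Qed.

Section empirical_covariance.
Context {R : realType} {H : hilbertType R}.
Variables (n : nat) (c : 'I_n -> H).

Let A f := n%:R^-1 *: \sum_i dot (c i) f *: c i.

Lemma rank_one_sum_linear : linear A.
Proof.
move=> k f g; rewrite /A scalerA mulrC -scalerA -scalerDr; congr (_ *: _).
rewrite scaler_sumr -big_split /=; apply: eq_bigr => i _.
by rewrite dotDr dotZr scalerDl scalerA.
Qed.

Lemma rank_one_sum_pos f : 0 <= dot f (A f).
Proof.
rewrite dotZr mulr_ge0 ?invr_ge0 // dot_sumr sumr_ge0 // => i _.
by rewrite dotZr dotC -expr2 sqr_ge0.
Qed.

Lemma rank_one_sum_le f : `|A f| <= (n%:R^-1 * \sum_i `|c i| ^+ 2) * `|f|.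
Proof.
rewrite normrZ ger0_norm ?invr_ge0 // -mulrA ler_wpM2l ?invr_ge0 //.
rewrite (le_trans (ler_norm_sum _ _ _)) // mulr_suml; apply: ler_sum => i _.
by rewrite normrZ expr2 mulrC -mulrA ler_wpM2l // cauchy_schwarz.
Qed.

End empirical_covariance.

(** * Rate of convergence *)

Section rates.
Context {R : realType}.
Variables (n : nat) (e alpha : R).
Hypotheses (n0 : (0 < n)%N) (e0 : 0 < e) (alpha0 : 0 < alpha).

Lemma powR_half_sq : (n%:R `^ (- 2^-1)) ^+ 2 = n%:R^-1 :> R.
Proof.
have nR : 0 < n%:R :> R by rewrite ltr0n.
rewrite expr2 -powRD; last by apply/implyP => _; rewrite gt_eqF.
by rewrite -(powR_inv1 (ltW nR)); congr (_ `^ _); field.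
Qed.

Lemma powR_rate_sq :
  (e `^ (- ((alpha + 1) / (2 * alpha)))) ^+ 2 = e `^ (- ((alpha + 1) / alpha)).
Proof.
rewrite expr2 -powRD; last by apply/implyP => _; rewrite gt_eqF.
by congr (_ `^ _); field; rewrite gt_eqF.
Qed.

(** Expanding the left-hand side, with [|An - A| = M1 n ^ (-1/2)], stochastic part
    [M1 n ^ (-1/2) e ^ (- (alpha + 1) / (2 alpha))] and bias [c e ^ g], gives the
    four terms of the rate, as [1 + (alpha + 1) / (2 alpha)] is
    [(3 alpha + 1) / (2 alpha)]. *)
Lemma rate_bound (M1 r c g : R) : 1 <= M1 -> 0 <= r -> 0 <= c ->
  (1 + M1 * n%:R `^ (- 2^-1) / e) *
  (M1 * n%:R `^ (- 2^-1) * e `^ (- ((alpha + 1) / (2 * alpha)))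
   + M1 * n%:R `^ (- 2^-1) * e `^ (- ((alpha + 1) / (2 * alpha))) * r
   + c * e `^ g) <=
  (M1 ^+ 2 * (1 + r) + 2 * M1 * c) *
  (n%:R `^ (- 2^-1) * e `^ (g - 1) + e `^ g
   + n%:R^-1 * e `^ (- ((3 * alpha + 1) / (2 * alpha)))
   + n%:R `^ (- 2^-1) * e `^ (- ((alpha + 1) / (2 * alpha)))).
Proof.
move=> M11 r0 c0; rewrite -powR_half_sq.
have -> : e `^ (g - 1) = e `^ g * e^-1.
  rewrite -(powR_inv1 (ltW e0)) -powRD //; apply/implyP => _; by rewrite gt_eqF.
have -> : e `^ (- ((3 * alpha + 1) / (2 * alpha))) =
    e^-1 * e `^ (- ((alpha + 1) / (2 * alpha))).
  rewrite -(powR_inv1 (ltW e0)) -powRD; last by apply/implyP => _; rewrite gt_eqF.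
  by congr (_ `^ _); field; rewrite gt_eqF.
set N := n%:R `^ _; set y := e `^ - _; set E := e `^ g.
have N0 : 0 <= N by exact: powR_ge0.
have y0 : 0 <= y by exact: powR_ge0.
have E0 : 0 <= E by exact: powR_ge0.
have i0 : 0 <= e^-1 by rewrite invr_ge0 ltW.
have M0 : 0 <= M1 by lra.
have MM : M1 <= M1 ^+ 2 by rewrite expr2 ler_peMl.
have t1 : 0 <= N * (E * e^-1) by rewrite !mulr_ge0.
have t3 : 0 <= N ^+ 2 * (e^-1 * y) by rewrite !mulr_ge0 // exprn_ge0.
have t4 : 0 <= N * y by rewrite mulr_ge0.
set K := M1 ^+ 2 * (1 + r) + 2 * M1 * c.
have K1 : M1 * c <= K.
  have : 0 <= M1 * c by rewrite mulr_ge0.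
  have : 0 <= M1 ^+ 2 * (1 + r) by rewrite mulr_ge0 ?exprn_ge0 ?addr_ge0.
  by rewrite /K; lra.
have K2 : c <= K by apply: le_trans K1; rewrite ler_peMl.
have K3 : M1 ^+ 2 * (1 + r) <= K by rewrite lerDl !mulr_ge0.
have K4 : M1 * (1 + r) <= K.
  by apply: le_trans K3; rewrite ler_wpM2r // addr_ge0.
have h1 := ler_wpM2r t1 K1.
have h2 := ler_wpM2r E0 K2.
have h3 := ler_wpM2r t3 K3.
have h4 := ler_wpM2r t4 K4.
clearbody K; nra.
Qed.

End rates.

Lemma probability_setU_le d (T : measurableType d) (R : realType)
    (P : probability T R) (A B : set T) (a b : R) :
  measurable A -> measurable B -> (P A <= a%:E)%E -> (P B <= b%:E)%E ->
  (P (A `|` B) <= (a + b)%:E)%E.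
Proof.
move=> mA mB PA PB; apply: le_trans (measureU2 P mA mB) _.
by rewrite EFinD leeD.
Qed.
Theorem theorem3p4 (R : realType)
  (dT : measure_display) (Omega : measurableType dT) (P : probability Omega R)
  (p q : nat) (OX : set 'rV[R]_p) (OY : set 'rV[R]_q)
  (OX0 : OX !=set0) (OY0 : OY !=set0)
  (X : {RV P >-> region OX0})
  (Y : {RV P >-> region OY0})
  (kappaX : region OX0 -> region OX0 -> R)
  (kappaY : region OY0 -> region OY0 -> R)
  (kappaX_pd : positive_definite_kernel kappaX)
  (kappaY_pd : positive_definite_kernel kappaY)
  (HX : rkhs kappaX) (HY : rkhs kappaY)
  (Xs : nat -> {RV P >-> region OX0})
  (Ys : nat -> {RV P >-> region OY0})
  (sample_iid : iid_copies P (fun w => (X w, Y w))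
                             (fun i w => (Xs i w, Ys i w)))
  (SigmaXX := cov_operator P HX HX X X)
  (SigmaXY := cov_operator P HX HY X Y)
  (RXY := regression_operator P HX HY X Y)
  (d : nat) (alpha beta : R) (lambda : nat -> R) (eps : nat -> R)
  (HX_dense : dense_mod_constants HX X)
  (HY_dense : dense_mod_constants HY Y)
  (kappaX_bounded : bounded_kernel kappaX)
  (kappaY_bounded : bounded_kernel kappaY)
  (kappaX_continuous : continuous_kernel kappaX)
  (kappaY_continuous : continuous_kernel kappaY)
  (range_sub : range SigmaXY `<=` range SigmaXX)
  (RXY_bounded : bounded_operator RXY)
  (cond_dominated : dominated_cond_distribution X Y)
  (sufficient : exists f : 'I_d -> HX, minimal_sufficient P X Y f)
  (RXY_rank : has_rank RXY d)
  (alpha_gt1 : 1 < alpha)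
  (lambda_eig : eigenvalues SigmaXX lambda)
  (lambda_decay : same_order lambda (fun j => j.+1%:R `^ (- alpha)))
  (beta_gt0 : 0 < beta)
  (smooth : exists (SigmaXX_pow : HX -> HX) (SXY : HY -> HX),
     [/\ is_operator_power SigmaXX (1 + beta) SigmaXX_pow,
         bounded_operator SXY &
         SigmaXY = SigmaXX_pow \o SXY])
  (eps_gt0 : forall n, 0 < eps n)
  (eps_cvg0 : eps @ \oo --> 0) :
  Op P
    (fun n w =>
       opnorm (sample_regression_operator HX HY (eps n) n
                 (fun i => Xs i w) (fun i => Ys i w) - RXY))
    (fun n =>
         n%:R `^ (- 2^-1) * eps n `^ (Num.min beta 1 - 1)
       + eps n `^ (Num.min beta 1)
       + n%:R^-1 * eps n `^ (- ((3 * alpha + 1) / (2 * alpha)))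
       + n%:R `^ (- 2^-1) * eps n `^ (- ((alpha + 1) / (2 * alpha)))).
Proof.
have kXs : forall x y, kappaX x y = kappaX y x := kappaX_pd.1.
have kYs : forall x y, kappaY x y = kappaY y x := kappaY_pd.1.
pose Z0 (w : Omega) : region OX0 * region OY0 := (X w, Y w).
pose Z (i : nat) (w : Omega) : region OX0 * region OY0 := (Xs i w, Ys i w).
have mZ0 : measurable_fun setT Z0 by exact: measurable_fun_pair.
have mZ i : measurable_fun setT (Z i) by exact: measurable_fun_pair.
pose F (z : region OX0 * region OY0) : HX := feature HX z.1.
pose G (z : region OX0 * region OY0) : HY := feature HY z.2.
have bF : bsm F.
  apply: (bsm_precomp (F := feature HX)); first exact: measurable_fst.
  exact: feature_bsm.
have bG : bsm G.
  apply: (bsm_precomp (F := feature HY)); first exact: measurable_snd.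
  exact: feature_bsm.
pose muX := mean_element P HX X; pose muY := mean_element P HY Y.
have meanX : is_mean P (fun w => F (Z0 w)) muX.
  by apply: bochner_is_mean; exact: bsm_precomp.
have covX f g : dot f (SigmaXX g) =
    \int[P]_w (dot f (F (Z0 w) - muX) * dot (F (Z0 w) - muX) g).
  apply: (dot_cross_bochner P (F := fun w => F (Z0 w) - muX) (G := fun w => F (Z0 w) - muX));
    by apply: bsmB; [exact: bsm_precomp|exact: bsm_cst].
have covXY f g : dot f (SigmaXY g) =
    \int[P]_w (dot f (F (Z0 w) - muX) * dot (G (Z0 w) - muY) g).
  apply: (dot_cross_bochner P (F := fun w => F (Z0 w) - muX) (G := fun w => G (Z0 w) - muY));
    by apply: bsmB; [exact: bsm_precomp|exact: bsm_cst].
have [BX BX0 FBX] := bsm_bounded (bsmB bF (bsm_cst muX)).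
have [BY BY0 GBY] := bsm_bounded (bsmB bG (bsm_cst muY)).
pose B := BX + BY.
have FB z : `|F z - muX| <= B by rewrite (le_trans (FBX z)) // lerDl.
have GB z : `|G z - muY| <= B by rewrite (le_trans (GBY z)) // lerDr.
have Alin : linear SigmaXX := cross_linear mZ0 bF bF covX.
have Clin : linear SigmaXY := cross_linear mZ0 bF bG covXY.
have AM := cross_le mZ0 bF bF covX FB FB.
have Asym := cov_sym covX.
have Apos := cov_pos covX.
have [Spow [S [[lam [phi [Aspec powE]]] [Slin Soo] CE]]] := smooth.
(* From here on [lam] and [phi] are the spectral decomposition that comes with
   the fractional power; its order is unrelated to that of [lambda]. *)
have Csource y j : 0 < lam j ->
    dot (phi j) (SigmaXY y) = lam j `^ (1 + beta) * dot (phi j) (S y).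
  move=> lj; rewrite CE; apply: dot_operator_power Aspec (powE (S y)) lj.
  by rewrite gt_eqF // addr_gt0.
(* A preimage of [SigmaXY y] may be replaced by its projection on the orthogonal
   complement of the kernel, which the Moore-Penrose inverse returns. *)
have RE y : SigmaXX (RXY y) = SigmaXY y /\ orthogonal_compl (operator_ker SigmaXX) (RXY y).
  have [x _ xE] := range_sub _ (imageT SigmaXY y).
  have Vx : orthogonal_compl (operator_ker SigmaXX) (eigen_proj lam phi x).
    by move=> f Af; rewrite dotC; exact: (ker_orth_proj Asym Aspec).
  have Ax : SigmaXX (eigen_proj lam phi x) = SigmaXY y.
    by rewrite (A_proj Alin Aspec) xE.
  have -> : RXY y = eigen_proj lam phi x.
    by rewrite /RXY /regression_operator /= -/SigmaXX -/SigmaXY -Ax moore_penroseK.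
  by split.
have RV f y : SigmaXX f = 0 -> dot f (RXY y) = 0.
  by move=> Af; rewrite dotC; exact: (RE y).2.
have Rsource y j : 0 < lam j ->
    dot (phi j) (RXY y) = lam j `^ beta * dot (phi j) (S y).
  move=> lj; apply: (mulfI (lt0r_neq0 lj)).
  have [_ _ eig _] := Aspec.
  rewrite /= -[LHS]dotZl -eig -Asym (RE y).1 Csource // mulrA powRD ?powRr1 ?ltW //.
  by apply/implyP => _; rewrite gt_eqF.
have [_ Roo] := RXY_bounded.
pose r := fine (opnorm RXY); have r0 : 0 <= r by exact: fine_opnorm_ge0.
have Rr y : `|RXY y| <= r * `|y| by exact: opnormP.
pose s0 := fine (opnorm S); have s00 : 0 <= s0 by exact: fine_opnorm_ge0.
have Ss y : `|S y| <= s0 * `|y| by exact: opnormP.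
have [c0 [D [c0_gt0 D0 lambdaB]]] := lambda_decay.
have lambda0 i : 0 < lambda i.
  have /andP[h _] := lambdaB i; apply: lt_le_trans h.
  by rewrite mulr_gt0 // powR_gt0.
have lambdaD i : lambda i <= D * i.+1%:R `^ (- alpha) by have /andP[] := lambdaB i.
have alpha0 : 0 < alpha by exact: lt_trans alpha_gt1.
pose K1 := D * (1 + (alpha - 1)^-1).
pose K2 := 1 + D * 2 `^ (alpha - 1) / (alpha - 1).
have K10 : 0 <= K1.
  by rewrite mulr_ge0 ?addr_ge0 ?invr_ge0 ?subr_ge0 ?(ltW alpha_gt1) ?(ltW D0).
have K20 : 0 <= K2.
  by rewrite addr_ge0 // !mulr_ge0 ?powR_ge0 ?invr_ge0 ?subr_ge0 ?(ltW alpha_gt1) ?(ltW D0).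
have sum1 m : \sum_(0 <= j < m | 0 < lam j) 1 * lam j <= K1.
  under eq_bigr do rewrite mul1r.
  apply: (sum_spectrum_le (g := id) Aspec lambda_eig lambda0) => [x /ltW //|N].
  exact: trace_bound.
have sum2 e m : 0 < e -> e <= 1 ->
    \sum_(0 <= j < m | 0 < lam j) (lam j + e)^-1 ^+ 2 * lam j <=
    K2 * e `^ (- ((alpha + 1) / alpha)).
  move=> e0 e1.
  under eq_bigr do rewrite mulrC exprVn.
  apply: (sum_spectrum_le (g := fun t => t / (t + e) ^+ 2) Aspec lambda_eig lambda0).
    by move=> x x0; rewrite divr_ge0 ?sqr_ge0 // ltW.
  by move=> N; exact: effective_dimension.
have phi1 j : 0 < lam j -> `|phi j| = 1 by exact: (norm_eigvec Aspec).
have phi_var j : 0 < lam j -> \int[P]_w (dot (phi j) (F (Z0 w) - muX) ^+ 2) = lam j.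
  move=> lj; rewrite -(cov_quadratic covX).
  have [_ _ eig _] := Aspec.
  by rewrite eig dotZr dot_norm phi1 // expr1n mulr1.
move=> eta eta0.
(* Each of the three events below has probability at most
   [4 B ^ 2 K / M1 ^ 2] with [K = K1] or [K = K2]; the summand [1] makes
   [M1 <= M1 ^ 2]. *)
pose M1 := 1 + 12 * B ^+ 2 * (K1 + K2) / eta.
have M11 : 1 <= M1.
  rewrite lerDl; apply: divr_ge0; last exact: ltW.
  by apply: mulr_ge0; [rewrite mulr_ge0 // sqr_ge0|exact: addr_ge0].
have M10 : 0 < M1 by exact: lt_le_trans M11.
pose cs := (1 + (B * B) `^ (beta - 1)) * s0.
have cs0 : 0 <= cs by rewrite mulr_ge0 // addr_ge0 // powR_ge0.
(* The summand [1] only ensures [0 < M]. *)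
pose M := M1 ^+ 2 * (1 + r) + 2 * M1 * cs + 1.
have M0 : 0 < M.
  apply: ltr_wpDl => //; apply: addr_ge0; apply: mulr_ge0 => //.
  - exact: sqr_ge0.
  - exact: addr_ge0.
  - by rewrite mulr_ge0 // ltW.
exists M; split => //.
have tail K : 0 <= K -> K <= K1 + K2 -> 4 * B ^+ 2 * K / M1 ^+ 2 <= eta / 3.
  move=> K0 KK; rewrite ler_pdivrMr ?exprn_gt0 //.
  have h1 : 12 * B ^+ 2 * (K1 + K2) <= eta * M1.
    have -> : eta * M1 = eta + 12 * B ^+ 2 * (K1 + K2) by rewrite /M1; field; rewrite gt_eqF.
    by rewrite lerDr ltW.
  have h2 : eta * M1 <= eta * M1 ^+ 2 by rewrite ler_pM2l // expr2 ler_peMl // ltW.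
  have h3 : B ^+ 2 * K <= B ^+ 2 * (K1 + K2) by rewrite ler_wpM2l ?sqr_ge0.
  have := le_trans h1 h2; lra.
have eps1 : \forall n \near \oo, eps n <= 1.
  exact: (cvgr_le _ eps_cvg0 _ ltr01).
near=> n.
have n0 : (0 < n)%N by near: n; exact: nbhs_infty_gt.
have e0 := eps_gt0 n; have e1 : eps n <= 1 by near: n.
set e := eps n in e0 e1 *.
have nR : 0 < n%:R :> R by rewrite ltr0n.
pose b := M1 * n%:R `^ (- 2^-1).
pose a := b * e `^ (- ((alpha + 1) / (2 * alpha))).
have b0 : 0 < b by rewrite mulr_gt0 // powR_gt0.
have a0 : 0 < a by rewrite mulr_gt0 // powR_gt0.
have b2 : b ^+ 2 = M1 ^+ 2 * n%:R^-1 by rewrite exprMn powR_half_sq.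
have a2 : a ^+ 2 = M1 ^+ 2 * n%:R^-1 * e `^ (- ((alpha + 1) / alpha)).
  by rewrite exprMn b2 powR_rate_sq.
have [E1 [mE1 PE1 hE1]] := sample_cross_concentration mZ0 mZ sample_iid bF bF
  meanX covX FB phi1 phi_var n0 (exprn_gt0 2 b0) (fun=> ler01) sum1.
have inv_ge0 j : 0 <= (lam j + e)^-1 ^+ 2 by rewrite sqr_ge0.
have [E2 [mE2 PE2 hE2]] := sample_cross_concentration mZ0 mZ sample_iid bF bF
  meanX covX FB phi1 phi_var n0 (exprn_gt0 2 a0) inv_ge0 (fun m => sum2 e m e0 e1).
have [E3 [mE3 PE3 hE3]] := sample_cross_concentration mZ0 mZ sample_iid bF bG
  meanX covXY GB phi1 phi_var n0 (exprn_gt0 2 a0) inv_ge0 (fun m => sum2 e m e0 e1).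
have [E0 [mE0 PE0 hE0]] := kernel_null_event mZ0 bF covX Aspec mZ sample_iid n.
exists ((E1 `|` E2 `|` E3) `|` E0); split.
- by do 3 apply: measurableU => //.
- move=> w /= Zw; apply: contrapT => /not_orP[/not_orP[/not_orP[nE1 nE2] nE3] nE0].
  move: Zw; apply/negP; rewrite -leNgt.
  have AnE : sample_cov_operator HX HX n (Xs^~ w) (Xs^~ w) = sample_cross Z F F n w.
    by apply/funext => f; rewrite /sample_cov_operator fctE fct_sumE.
  have CnE : sample_cov_operator HX HY n (Xs^~ w) (Ys^~ w) = sample_cross Z F G n w.
    by apply/funext => f; rewrite /sample_cov_operator fctE fct_sumE.
  have Fker i f : (i < n)%N -> SigmaXX f = 0 -> dot f (F (Z i w)) = dot f muX.
    by move=> lt_in Af; apply/eqP; rewrite -subr_eq0 -dotBr; apply/eqP; exact: hE0.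
  have Anlin : linear (sample_cross Z F F n w) by exact: rank_one_sum_linear.
  have Anpos f : 0 <= dot f (sample_cross Z F F n w f) by exact: rank_one_sum_pos.
  have source x : exists2 z, SigmaXX z + e *: z = e *: RXY x &
      `|z| <= cs * e `^ (Num.min beta 1) * `|x|.
    have [z zE zle] := source_bound Alin AM Asym Aspec Apos e0 beta_gt0
      (fun f Af => RV f x Af) (fun j lj => Rsource x j lj).
    exists z => //; apply: le_trans zle _.
    have -> : cs * e `^ Num.min beta 1 * `|x| =
        (1 + (B * B) `^ (beta - 1)) * e `^ Num.min beta 1 * (s0 * `|x|).
      by rewrite /cs; ring.
    by rewrite ler_wpM2l // mulr_ge0 ?addr_ge0 ?powR_ge0.
  have Cker f x : SigmaXX f = 0 -> dot f (sample_cross Z F G n w x - SigmaXY x) = 0.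
    move=> Af; rewrite dotBr (@sample_cross_orth _ _ _ _ _ _ _ _ _ _ f (dot f muX)) //; last first.
      by move=> i lt_in; exact: Fker.
    rewrite (cross_zero_variance mZ0 bF bG covXY) ?subrr //.
    exact: (cov_ker covX).
  have Aker f x : SigmaXX f = 0 -> dot f (sample_cross Z F F n w x - SigmaXX x) = 0.
    move=> Af; rewrite dotBr (@sample_cross_orth _ _ _ _ _ _ _ _ _ _ f (dot f muX)) //; last first.
      by move=> i lt_in; exact: Fker.
    by rewrite Asym Af dot0l subrr.
  set rate := (X in M * X); have rate0 : 0 <= rate.
    by rewrite !addr_ge0 ?mulr_ge0 ?powR_ge0 ?invr_ge0.
  apply: opnorm_le => [|x]; first by rewrite mulr_ge0 // ltW.
  rewrite fctE /sample_regression_operator /= AnE CnE.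
  have reg := (regularized_error Alin AM Asym Aspec Apos Anlin
    (rank_one_sum_le _) Anpos e0 (ltW a0) (ltW b0) (fun x => (RE x).1) Rr Cker Aker
    (hE1 w nE1) (hE2 w nE2) (hE3 w nE3) source x).
  apply: le_trans reg _.
  rewrite ler_wpM2r //; apply: le_trans (rate_bound n0 e0 alpha0 _ M11 r0 cs0) _.
  by rewrite ler_wpM2r // lerDl.
- have -> : eta = eta / 3 + eta / 3 + eta / 3 + 0 by rewrite addr0; field.
  apply: probability_setU_le => //; first by do 2 apply: measurableU => //.
  apply: probability_setU_le => //; first exact: measurableU.
    apply: probability_setU_le => //.
      apply: le_trans PE1 _; rewrite lee_fin b2.
      have -> : 4 * B ^+ 2 * (n%:R^-1 * K1) / (M1 ^+ 2 * n%:R^-1) = 4 * B ^+ 2 * K1 / M1 ^+ 2.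
        by field; rewrite !gt_eqF.
      by apply: tail => //; rewrite lerDl.
    apply: le_trans PE2 _; rewrite lee_fin a2.
    have -> : 4 * B ^+ 2 * (n%:R^-1 * (K2 * e `^ (- ((alpha + 1) / alpha)))) /
        (M1 ^+ 2 * n%:R^-1 * e `^ (- ((alpha + 1) / alpha))) = 4 * B ^+ 2 * K2 / M1 ^+ 2.
      by field; rewrite !gt_eqF ?powR_gt0.
    by apply: tail => //; rewrite lerDr.
  apply: le_trans PE3 _; rewrite lee_fin a2.
  have -> : 4 * B ^+ 2 * (n%:R^-1 * (K2 * e `^ (- ((alpha + 1) / alpha)))) /
      (M1 ^+ 2 * n%:R^-1 * e `^ (- ((alpha + 1) / alpha))) = 4 * B ^+ 2 * K2 / M1 ^+ 2.
    by field; rewrite !gt_eqF ?powR_gt0.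
  by apply: tail => //; rewrite lerDr.
Unshelve. all: by end_near. Qed.
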